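(* Let $\mathcal{X}=(X_1,\dots,X_n)$ be an irreducible weak Delone multiset family satisfying the inflation functional equation $\psi(\mathcal{X})=\mathcal{X}$ for the data $(A,\mathcal{D}_{ij})$, where the subdivision matrix $S=[|\mathcal{D}_{ij}|]_{1\le i,j\le n}$ is primitive. Suppose that the fundamental cycle of $\mathcal{X}$ has period $1$. Then $\mathcal{X}$ is a self-replicating multi-tiling family.
   Context: Fix integers $d,n\ge 1$, an expanding real $d\times d$ matrix $A$ (all eigenvalues, real or complex, have absolute value $>1$), and finite, possibly empty, sets $\mathcal{D}_{ij}\subset\mathbb{R}^d$ for $1\le i,j\le n$. A nonnegative real square matrix is primitive if some power has all entries strictly positive. A multiset $X$ in $\mathbb{R}^d$ is a set $\underline{X}\subset\mathbb{R}^d$ (the underlying set) with a multiplicity function $m_X:\underline{X}\to\mathbb{Z}_{>0}$, extended by $0$ off $\underline{X}$. $X\subseteq Y$ means $m_X\le m_Y$. The multiset union $X\vee Y$ has multiplicity function $m_X+m_Y$. $A(X)$ has multiplicity $m_X(A^{-1}\mathbf{x})$ at $\mathbf{x}$, and $X+\mathcal{D}=\bigvee_{\mathbf{d}\in\mathcal{D}}(X+\mathbf{d})$. A multiset family is a vector $\mathcal{X}=(X_1,\dots,X_n)$ of multisets in $\mathbb{R}^d$, with componentwise inclusion. The inflation operator is $\psi(\mathcal{X})=(X_1',\dots,X_n')$ with $X_i'=\bigvee_{j=1}^n(A(X_j)+\mathcal{D}_{ij})$. A nonempty $\mathcal{X}$ with $\psi(\mathcal{X})=\mathcal{X}$ is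 irreducible if there is no nonempty multiset family $\mathcal{X}'\subseteq\mathcal{X}$, $\mathcal{X}'\neq\mathcal{X}$, with $\psi(\mathcal{X}')=\mathcal{X}'$. A multiset $X$ is weakly uniformly discrete if there are $r>0$ and a finite $m\ge1$ such that any open ball of radius $r$ contains at most $m$ points of $X$ counted with multiplicity; uniformly discrete if this holds with $m=1$ for some $r>0$; relatively dense if for some finite $R>0$ each closed ball of radius $R$ contains a point of $X$. A weak Delone multiset is weakly uniformly discrete and relatively dense; a Delone set is uniformly discrete (hence an ordinary set) and relatively dense. A weak Delone multiset family is a multiset family satisfying the inflation functional equation with each $X_i$ a weak Delone multiset. Fundamental (generating) cycle: let $\mathcal{G}(\mathcal{X})$ be the directed graph with vertices $(\mathbf{x},i)$, $\mathbf{x}\in\underline{X_i}$, and an edge $(\mathbf{x},j)\to(A\mathbf{x}+\mathbf{d},i)$ for each $\mathbf{d}\in\mathcal{D}_{ij}$. For an irreducible weak Delone multiset family $\mathcal{X}$ with $\psi(\mathcal{X})=\mathcal{X}$ this graph has exactly one directed cycle (with distinct vertices, possibly a loop, up to rotation); this is the fundamental cycle and its period is its number of vertices. The associated multi-tile functional equation is $A(T_i)=\bigcup_{j=1}^n(T_j+\mathcal{D}_{ji})$, $1\le i\le n$ (ordinary set union). A multiset family $\mathcal{X}$ is a self-replicating multi-tiling family for $(A,\mathcal{D}_{ij})$ if: (a) $\psi(\mathcal{X})=\mathcal{X}$ and each $X_i$ is a Delone set; (b) the associated multi-tile equation has a unique (nonempty compact) solution $(T_1,\dots,T_n)$, and each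 $T_i$ has positive Lebesgue measure; (c) the sets $\{T_i+\mathbf{x}_i:1\le i\le n,\ \mathbf{x}_i\in X_i\}$ tile $\mathbb{R}^d$, i.e. they cover $\mathbb{R}^d$ and any two of them with distinct indices $(i,\mathbf{x}_i)$ intersect in a set of Lebesgue measure zero. *)

(* Defs.v *)
From HB Require Import structures.
From mathcomp Require Import all_boot all_order all_algebra finmap.
From mathcomp Require Import all_classical all_reals all_analysis.
From mathcomp Require Import complex.

Set Implicit Arguments.
Unset Strict Implicit.
Unset Printing Implicit Defensive.

Import Order.TTheory GRing.Theory Num.Theory.
Import numFieldNormedType.Exports.

Local Open Scope classical_set_scope.
Local Open Scope ring_scope.

Section Matrices.
Context {R : realType}.

(* The eigenvalues are taken over the complex numbers R[i]; the order of R[i]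
   compares two elements only when their difference is real, which is the case
   for 1 and a modulus. *)
Definition expanding d (A : 'M[R]_d) : Prop :=
  forall a : R[i], eigenvalue (map_mx (real_complex R) A) a -> 1 < `|a|.

(* The exponent is positive: with exponent 0 the 1 x 1 zero matrix would be
   primitive. *)
Definition primitive_mx n (S : 'M[R]_n) : Prop :=
  (forall i j, 0 <= S i j) /\
  exists2 k, (0 < k)%N & forall i j, 0 < (S ^+ k) i j.

End Matrices.

Section Multisets.
Context {R : realType} {d : nat}.
Implicit Types x c : 'cV[R]_d.

(* The library norm on matrices is the max norm. *)
Definition enorm x : R := Num.sqrt (\sum_i x i 0 ^+ 2).

(* A multiset is given by its multiplicity function, extended by 0. *)
Definition multiset := 'cV[R]_d -> nat.
Implicit Types X Y : multiset.

Definition msupp X : set 'cV[R]_d := [set x | (0 < X x)%N].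

Definition msubset X Y : Prop := forall x, (X x <= Y x)%N.

Definition mslin (A : 'M[R]_d) X : multiset := fun x => X (invmx A *m x).

Definition msshift X (E : {fset 'cV[R]_d}) : multiset :=
  fun x => (\sum_(e <- E) X (x - e)%R)%N.

(* The number of points of X in B, counted with multiplicity. *)
Definition mscount X (B : set 'cV[R]_d) : \bar R :=
  \esum_(x in B) ((X x)%:R)%:E.

Definition discrete_with (r : R) (m : nat) X : Prop :=
  forall c, (mscount X [set x | (enorm (x - c) < r)%R] <= (m%:R)%:E)%E.

Definition weakly_uniformly_discrete X : Prop :=
  exists (r : R) (m : nat), [/\ 0 < r, (1 <= m)%N & discrete_with r m X].

Definition uniformly_discrete X : Prop :=
  exists2 r : R, 0 < r & discrete_with r 1 X.

Definition relatively_dense X : Prop :=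
  exists2 r : R, 0 < r &
    forall c, exists2 x, msupp X x & enorm (x - c) <= r.

Definition weak_delone X : Prop :=
  weakly_uniformly_discrete X /\ relatively_dense X.

Definition delone X : Prop := uniformly_discrete X /\ relatively_dense X.

End Multisets.
Arguments multiset : clear implicits.

Section LebesgueMeasure.
Context {R : realType} {d : nat}.

Definition box (ab : 'cV[R]_d * 'cV[R]_d) : set 'cV[R]_d :=
  [set x | forall i, ab.1 i 0 < x i 0 <= ab.2 i 0].

Definition box_volume (ab : 'cV[R]_d * 'cV[R]_d) : R :=
  \prod_i Num.max 0 (ab.2 i 0 - ab.1 i 0).

(* Lebesgue outer measure on R^d, which is the Lebesgue measure on the
   measurable sets; it is only applied below to compact sets. *)
Definition lebesgue (E : set 'cV[R]_d) : \bar R :=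
  ereal_inf [set (\sum_(0 <= k <oo) (box_volume (F k))%:E)%E |
             F in [set F : nat -> 'cV[R]_d * 'cV[R]_d |
                   E `<=` \bigcup_k box (F k)]].

End LebesgueMeasure.

Section Inflation.
Context {R : realType} {d n : nat}.
Variables (A : 'M[R]_d) (D : 'I_n -> 'I_n -> {fset 'cV[R]_d}).

Definition multiset_family := 'I_n -> multiset R d.
Implicit Types X Y : multiset_family.

Definition family_nonempty X : Prop := exists i, msupp (X i) !=set0.

Definition family_subset X Y : Prop := forall i, msubset (X i) (Y i).

Definition inflation X : multiset_family :=
  fun i x => (\sum_j msshift (mslin A (X j)) (D i j) x)%N.

Definition subdivision_matrix : 'M[R]_n := \matrix_(i, j) (#|` D i j|)%:R.

Definition irreducible_family X : Prop :=
  [/\ family_nonempty X, inflation X = X &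
      forall Y, family_nonempty Y -> family_subset Y X ->
        inflation Y = Y -> Y = X].

Definition weak_delone_family X : Prop :=
  inflation X = X /\ forall i, weak_delone (X i).

(* The graph G(X): the vertices are the pairs (x, i) with x in the support of
   X i. *)
Definition graph_vertex X : pred ('cV[R]_d * 'I_n) :=
  fun v => (0 < X v.2 v.1)%N.

Definition graph_edge : rel ('cV[R]_d * 'I_n) :=
  fun v w => has (fun e => w.1 == A *m v.1 + e) (D w.2 v.2).

(* A directed cycle of G(X), listed from one of its vertices; its period is
   its size.  When X is an irreducible weak Delone family there is exactly one
   such cycle up to rotation; this is a consequence of irreducibility and is
   not made part of the definition. *)
Definition fundamental_cycle X (c : seq ('cV[R]_d * 'I_n)) : Prop :=
  [/\ c != [::], uniq c, all (graph_vertex X) c & cycle graph_edge c].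

Definition translate (T : set 'cV[R]_d) (x : 'cV[R]_d) : set 'cV[R]_d :=
  [set t + x | t in T].

(* The indices of D are transposed with respect to the inflation operator. *)
Definition multitile_solution (T : 'I_n -> set 'cV[R]_d) : Prop :=
  (forall i, T i !=set0 /\ compact (T i)) /\
  forall i, [set A *m t | t in T i] =
            \bigcup_j \bigcup_(e in [set` D j i]) translate (T j) e.

Definition tiles_space (T : 'I_n -> set 'cV[R]_d) X : Prop :=
  \bigcup_i \bigcup_(x in msupp (X i)) translate (T i) x = setT /\
  forall i j x y, msupp (X i) x -> msupp (X j) y -> (i, x) <> (j, y) ->
    lebesgue (translate (T i) x `&` translate (T j) y) = 0%E.

Definition self_replicating X : Prop :=
  [/\ inflation X = X, forall i, delone (X i) &
      exists T, [/\ multitile_solution T,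
                    forall T', multitile_solution T' -> T' = T,
                    forall i, (0 < lebesgue (T i))%E &
                    tiles_space T X]].

End Inflation.
Arguments multiset_family : clear implicits.

(* Main.v *)
Require Import Defs.
From HB Require Import structures.
From mathcomp Require Import all_boot all_order all_algebra finmap.
From mathcomp Require Import all_classical all_reals all_analysis.
From mathcomp Require Import complex ring lra.

Import Order.TTheory GRing.Theory Num.Theory.
Import numFieldNormedType.Exports.

Local Open Scope classical_set_scope.
Local Open Scope ring_scope.

(** The tiling is governed by the graph whose edges go from a vertex (x, j) to its
    children (A x + e, i), for e in D i j.  The k-th inflation of a point counts its
    descendants of level k, and these are translated when the point is.

    Combinatorics.  A fundamental cycle of period 1 is a vertex v0 which is its own
    child.  Its descendants increase with the level and have a limit fixed by the
    inflation; irreducibility forces the limit to be X.  So any finite part of X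
    descends from v0 at one common level ([generated_seq]), and, up to translation,
    it recurs below every vertex by primitivity.  Two consequences: a multiplicity
    above 1 would recur below itself and multiply without bound, against weak uniform
    discreteness ([multiplicity_le1]); hence distinct vertices have no common
    descendant ([desc_disjoint]).

    Geometry.  A norm for which the inverse of A contracts in one step is derived from
    the eigenvalue condition by the Cayley-Hamilton theorem ([adapted_norm_exists]).
    The contraction gives a unique compact solution T of the multi-tile equation
    ([multitile_exists], [solution_sub]), and the equation says that the tile of a
    vertex is the union of the shrunken tiles of its descendants of any level
    ([tile_desc]).  Relative density and contraction make the tiles cover the space
    ([tiles_cover]); as they are locally finite, each of them contains a ball
    ([tile_has_ball]).  Two distinct tiles share no ball ([tiles_overlap_free]): in a
    ball shared by several tiles, and magnified enough, a translate of the whole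
    configuration recurs among the descendants of the first tile, whereas the
    descendants of the second cover it once more, so that arbitrarily many tiles would
    share a point.  Uniform discreteness of each X i follows at once, since two close
    points of the same type have tiles that share a ball.

    Measure.  Let two distinct tiles touch.  A fixed number of levels below each
    vertex, some descendants of every type have their tiles inside the tile of that
    vertex, away from the other tiles; so the proportion of the descendants of the
    first tile that touch the second decays geometrically ([contact_desc_count]).  The
    volume of one shrunken tile is at most a constant over the number of descendants
    of its type, by a double count of the cells of a fine grid ([piece_volume]).  So
    the contact set has finite covers by boxes of arbitrarily small total volume
    ([contact_null]).  In the other direction, the tiles have positive measure because
    they contain cubes ([lebesgue_cube_ge]). *)

(** * The inverse of an expanding matrix contracts an adapted norm *)

Section Contraction.
Context {R : realType}.

Lemma expr_lt_eps (q e : R) : 0 <= q -> q < 1 -> 0 < e -> exists k, q ^+ k < e.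
Proof.
move=> q0 q1 e0.
have : (GRing.exp (R:=R) q : R^nat) x @[x --> \oo] --> 0.
  by apply: cvg_expr; rewrite ger0_norm.
move=> /cvgr0Pnorm_lt/(_ e e0)[k _ /(_ k (leqnn k))].
by rewrite /= ger0_norm ?exprn_ge0// => ?; exists k.
Qed.

(** A one-sided form of convergence to 0, meant for sequences of moduli. *)
Definition vanishing (u : nat -> R) :=
  forall e, 0 < e -> exists K, forall k, (K <= k)%N -> u k <= e.

(** The recurrence is a contraction up to a vanishing error.  Once the error is
    at most (1 - q) * (eps / 2), the bound q ^ j * u K + eps / 2 propagates. *)
Lemma vanishing_rec (q : R) (u e : nat -> R) : 0 <= q -> q < 1 ->
  (forall k, 0 <= u k) -> vanishing e ->
  (forall k, u k.+1 <= q * (u k + e k.+1)) -> vanishing u.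
Proof.
move=> q0 q1 u0 ve ur eps eps0.
have [K eK] := ve ((1 - q) * (eps / 2)) ltac:(nra).
have step j : u (K + j)%N <= q ^+ j * u K + eps / 2.
  elim: j => [|j IH]; first by rewrite addn0 expr0 mul1r; lra.
  rewrite addnS; apply: le_trans (ur _) _.
  have := eK (K + j).+1 ltac:(by rewrite ltnW// ltnS leq_addr).
  rewrite exprS; set x := q ^+ j * _ in IH *; set y := e _ => ey.
  rewrite -mulrA -/x.
  have : q * (u (K + j)%N + y) <= q * (x + eps / 2 + (1 - q) * (eps / 2)).
    by apply: ler_wpM2l => //; apply: lerD.
  have : 0 <= (1 - q) * (1 - q) * eps by rewrite !mulr_ge0//; lra.
  nra.
have [k kq] := expr_lt_eps q (eps / 2 / (u K + 1)) q0 q1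
  ltac:(by rewrite !divr_gt0// ltr_wpDl).
exists (K + k)%N => l Kkl; rewrite -(subnKC Kkl) -addnA.
apply: le_trans (step _) _.
have -> : eps = eps / 2 + eps / 2 by lra.
apply: lerD => //; last by lra.
rewrite exprD.
have qk := exprn_ge0 k q0.
have ql : q ^+ (l - (K + k)) <= 1 by rewrite exprn_ile1// ltW.
have ql0 := exprn_ge0 (l - (K + k)) q0.
have : q ^+ k * (u K + 1) < eps / 2.
  by rewrite -ltr_pdivlMr// ltr_wpDl.
have := u0 K.
move: (u K) (q ^+ k) (q ^+ _) qk ql ql0 => a b c b0 c1 c0 a0 H.
have : b * c * a <= b * a by rewrite -mulrA ler_wpM2l// ler_piMl.
nra.
Qed.

Import Normc.

Lemma normcB_le (x y : R[i]) : normc (x - y) <= normc x + normc y.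
Proof. by apply: le_trans (le_normcD x (- y)) _; rewrite (normcN y). Qed.

(** Induction on the roots replaces W by (B - r) W, which has one factor less to
    be killed by; the powers of the inverse on W and on (B - r) W are then tied by
    the recurrence of [vanishing_rec] with ratio 1 / |r|.  With W = 1 and the roots
    of the characteristic polynomial, the hypothesis is Cayley-Hamilton. *)
Lemma invmx_pow_vanishing_complex d (B : 'M[R[i]]_d.+1) (rs : seq R[i])
    (W : 'M[R[i]]_d.+1) : B \in unitmx ->
  (forall r, r \in rs -> 1 < normc r) ->
  horner_mx B (\prod_(r <- rs) ('X - r%:P)) * W = 0 ->
  forall i j, vanishing (fun k => normc ((invmx B ^+ k * W) i j)).
Proof.
move=> uB; elim: rs W => [|r rs IH] W hr.
  rewrite big_nil rmorph1 mul1r => -> i j e e0; exists 0%N => k _.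
  by rewrite mulr0 mxE normc0 ltW.
rewrite big_cons mulrC rmorphM /= -mulrA.
set W' := _ * W => hW'.
have W'E : W' = B * W - r *: W.
  rewrite /W' rmorphB /= horner_mx_X horner_mx_C mulrBl; congr (_ - _).
  exact: mul_scalar_mx.
have r1 : 1 < normc r by apply: hr; rewrite mem_head.
have {}IH := IH W' (fun s sr => hr s (ltac:(by rewrite inE sr orbT))) hW'.
move=> i j; apply: (@vanishing_rec (normc r)^-1 _
  (fun k => normc ((invmx B ^+ k * W') i j))).
- by rewrite invr_ge0 ltW// (lt_trans _ r1).
- by rewrite invf_lt1// (lt_trans _ r1).
- by move=> k; case: (_ i j) => a b; exact: sqrtr_ge0.
- exact: IH.
move=> k.
have r0 : r != 0.
  by apply/eqP => r0; move: r1; rewrite r0 normc0 ltr10.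
suff -> : (invmx B ^+ k.+1 * W) i j =
    r^-1 * ((invmx B ^+ k * W) i j - (invmx B ^+ k.+1 * W') i j).
  rewrite normcM normcV ler_wpM2l ?normcB_le//.
  by rewrite invr_ge0 ltW// (lt_trans _ r1).
apply: (mulfI r0); rewrite mulrA mulfV// mul1r.
have -> : invmx B ^+ k.+1 * W' = invmx B ^+ k * W - r *: (invmx B ^+ k.+1 * W).
  rewrite W'E mulrBr mulrA exprSr -[_ * invmx B * B]mulrA.
  have -> : invmx B * B = 1 by rewrite -mulmxE mulVmx.
  by rewrite mulr1 -scalerAr.
set P := _ * W; set Q := _ * W.
by rewrite !mxE opprB addrC subrK.
Qed.

Lemma expanding_unitmx {d} (A : 'M[R]_d) : expanding A -> A \in unitmx.
Proof.
move=> hA; apply/negP => /negP nA.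
have : eigenvalue (map_mx (real_complex R) A) 0.
  rewrite eigenvalue_root_char /root horner_coef0 char_poly_det det_map_mx.
  move: nA; rewrite unitmxE unitfE negbK => /eqP ->.
  by rewrite rmorph0 mulr0.
by move=> /hA; rewrite normr0 ltr10.
Qed.

Lemma expanding_pow_vanishing d (A : 'M[R]_d.+1) : expanding A ->
  forall i j, vanishing (fun k => `|(invmx A ^+ k) i j|).
Proof.
move=> hA i j.
set B := map_mx (real_complex R) A.
have uA := expanding_unitmx _ hA.
have uB : B \in unitmx by rewrite map_unitmx.
have [rs rsE] := closed_field_poly_normal (char_poly B).
have CH := Cayley_Hamilton B.
move: rsE; rewrite (monicP (char_poly_monic B)) scale1r => rsE.
have hr r : r \in rs -> 1 < normc r.
  move=> rrs; have : eigenvalue B r.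
    by rewrite eigenvalue_root_char rsE root_prod_XsubC.
  by move=> /hA; rewrite -ltcR.
rewrite rsE in CH.
have := @invmx_pow_vanishing_complex _ B rs 1 uB hr _ i j.
rewrite CH mul0r => /(_ erefl) v e e0; have [K vK] := v e e0.
exists K => k /vK; rewrite mulr1.
suff -> : (invmx B ^+ k) i j = real_complex R ((invmx A ^+ k) i j).
  by rewrite /= expr0n /= addr0 sqrtr_sqr.
suff -> : invmx B ^+ k = map_mx (real_complex R) (invmx A ^+ k) by rewrite mxE.
by rewrite rmorphXn /= map_invmx.
Qed.

Definition l1norm {d} (x : 'cV[R]_d) : R := \sum_i `|x i 0|.

Lemma l1norm_ge0 d (x : 'cV[R]_d) : 0 <= l1norm x.
Proof. exact: sumr_ge0. Qed.

Lemma l1normD d (x y : 'cV[R]_d) : l1norm (x + y) <= l1norm x + l1norm y.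
Proof. by rewrite -big_split ler_sum// => i _; rewrite mxE ler_normD. Qed.

Lemma l1normN d (x : 'cV[R]_d) : l1norm (- x) = l1norm x.
Proof. by apply: eq_bigr => i _; rewrite mxE normrN. Qed.

Lemma ler_coord_l1norm d (x : 'cV[R]_d) i : `|x i 0| <= l1norm x.
Proof. by rewrite /l1norm (bigD1 i)//= lerDl sumr_ge0. Qed.

Lemma l1norm_mulmx d (G : 'M[R]_d) (x : 'cV[R]_d) :
  l1norm (G *m x) <= (\sum_i \sum_j `|G i j|) * l1norm x.
Proof.
rewrite mulr_suml ler_sum// => i _; rewrite mxE.
apply: le_trans (ler_norm_sum _ _ _) _.
rewrite mulr_suml ler_sum// => j _.
by rewrite normrM ler_wpM2l// ler_coord_l1norm.
Qed.

(** A norm equivalent to the l1 norm for which the inverse of A contracts in one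
    step.  Such a norm spares the constants and the iterates that the fixed norms
    would require in every later estimate. *)
Record adapted_norm {d} (A : 'M[R]_d) (th C : R) (N : 'cV[R]_d -> R) : Prop := {
  adapted_th0 : 0 < th;
  adapted_th1 : th < 1;
  adapted_C0 : 0 < C;
  adaptedD : forall x y, N (x + y) <= N x + N y;
  adaptedN : forall x, N (- x) = N x;
  adapted_ge : forall x, l1norm x <= N x;
  adapted_le : forall x, N x <= C * l1norm x;
  adapted_contract : forall x, N (invmx A *m x) <= th * N x }.

(** If the power K + 1 of the inverse halves the l1 norm, sum the l1 norms of the
    first K + 1 iterates with weights 1 + k / (K + 1).  Under one
    more application each norm meets the previous weight, smaller by 1 / (K + 1),
    which is at least the fraction 1 / (2 (K + 1)) of a weight at most 2; the last
    norm, of weight below 2, is compared with the first by the halving. *)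
Lemma adapted_norm_exists d (A : 'M[R]_d) : (0 < d)%N -> expanding A ->
  exists th C N, adapted_norm A th C N.
Proof.
case: d A => // d A _ hA.
have [K hK] : exists K, forall x, l1norm (invmx A ^+ K.+1 *m x) <=
    2^-1 * l1norm x.
  pose e : R := (2 * (d.+1%:R * d.+1%:R))^-1.
  have e0 : 0 < e by rewrite invr_gt0 !mulr_gt0.
  have /choice[k hk] : forall i, exists K, forall j k, (K <= k)%N ->
      `|(invmx A ^+ k) i j| <= e.
    move=> i.
    have /choice[k hk] : forall j, exists K, forall k, (K <= k)%N ->
        `|(invmx A ^+ k) i j| <= e.
      by move=> j; apply: expanding_pow_vanishing.
    exists (\max_j k j)%N => j l kl; apply: hk; apply: leq_trans kl.
    exact: leq_bigmax.
  exists (\max_i k i)%N => x; apply: le_trans (l1norm_mulmx _ _ _) _.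
  apply: ler_wpM2r; first exact: l1norm_ge0.
  have -> : 2^-1 = \sum_(i < d.+1) \sum_(j < d.+1) e.
    rewrite !sumr_const card_ord -[e *+ _]mulr_natr -[RHS]mulr_natr -mulrA /e invfM.
    by rewrite divfK// mulf_neq0.
  apply: ler_sum => i _; apply: ler_sum => j _; apply: hk.
  by apply: leqW; apply: leq_bigmax.
pose t : R := K.+1%:R^-1.
have t0 : 0 < t by rewrite invr_gt0.
have t1 : t <= 1 by rewrite invf_le1// ler1n.
have tK : K%:R * t = 1 - t.
  by rewrite /t -[X in X - _](@mulfV _ K.+1%:R)// -[X in _ - X]mul1r -mulrBl
     -natr1 addrK.
pose w (k : nat) : R := 1 + k%:R * t.
have w1 k : 1 <= w k by rewrite /w lerDl mulr_ge0// ltW.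
have w0 k : 0 <= w k by exact: le_trans (w1 k).
pose N x := \sum_(k < K.+1) w k * l1norm (invmx A ^+ k *m x).
pose C := \sum_(k < K.+1) w k * (\sum_i \sum_j `|(invmx A ^+ k) i j|).
exists (1 - t / 2), (1 + C), N.
have C0 : 0 <= C.
  apply: sumr_ge0 => k _; rewrite mulr_ge0//.
  by apply: sumr_ge0 => i _; apply: sumr_ge0.
split.
- by lra.
- by lra.
- by rewrite ltr_wpDr.
- move=> x y; rewrite /N -big_split ler_sum// => k _ /=.
  by rewrite -mulrDr ler_wpM2l// mulmxDr l1normD.
- by move=> x; apply: eq_bigr => k _; rewrite mulmxN l1normN.
- move=> x; rewrite /N big_ord_recl /= expr0 /w mul0r addr0 !mul1r mul1mx.
  rewrite lerDl; apply: sumr_ge0 => k _; apply: mulr_ge0; last exact: l1norm_ge0.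
  exact: (w0 (bump 0 k)).
- move=> x; apply: (@le_trans _ _ (C * l1norm x)).
    rewrite mulr_suml ler_sum// => k _.
    by rewrite -mulrA ler_wpM2l// l1norm_mulmx.
  by rewrite ler_wpM2r ?l1norm_ge0// lerDr.
move=> x; rewrite /N big_ord_recr /= [X in _ <= _ * X]big_ord_recl /=.
rewrite addrC mulrDr; apply: lerD.
  rewrite mulmxA mulmxE -exprSr /w mul0r addr0 mul1r expr0 mul1mx tK.
  have := hK x; have := l1norm_ge0 _ x; nra.
rewrite mulr_sumr ler_sum// => k _; rewrite mulrA mulmxA mulmxE -exprSr.
apply: ler_wpM2r; first exact: l1norm_ge0.
rewrite /w /bump /= add1n.
have : k.+1%:R * t <= 1.
  rewrite -ler_pdivlMr// div1r /t invrK ler_nat.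
  by rewrite ltnS ltnW.
rewrite -natr1; nra.
Qed.

End Contraction.

(** * Topology through an adapted norm *)

Section AdaptedNorm.
Context {R : realType} {d : nat} {A : 'M[R]_d} {th C : R} {N : 'cV[R]_d -> R}.
Hypothesis uA : A \in unitmx.
Hypothesis hN : adapted_norm A th C N.
Implicit Types (x y p q : 'cV[R]_d) (S : set 'cV[R]_d).

Local Notation th0 := (adapted_th0 _ _ _ _ hN).
Local Notation th1 := (adapted_th1 _ _ _ _ hN).
Local Notation C0 := (adapted_C0 _ _ _ _ hN).
Local Notation ND := (adaptedD _ _ _ _ hN).
Local Notation NN := (adaptedN _ _ _ _ hN).
Local Notation Nge := (adapted_ge _ _ _ _ hN).
Local Notation Nle := (adapted_le _ _ _ _ hN).
Local Notation Ncontract := (adapted_contract _ _ _ _ hN).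

Lemma adapted_ge0 x : 0 <= N x.
Proof. exact: le_trans (l1norm_ge0 _ _) (Nge x). Qed.

Lemma adapted0 : N 0 = 0.
Proof.
apply/eqP; rewrite eq_le adapted_ge0 andbT; apply: le_trans (Nle 0) _.
by rewrite /l1norm big1 ?mulr0// => i _; rewrite mxE normr0.
Qed.

Lemma adaptedB x y : N (x - y) <= N x + N y.
Proof. by rewrite -[N y]NN; exact: ND. Qed.

Lemma adapted_sym x y : N (x - y) = N (y - x).
Proof. by rewrite -NN opprB. Qed.

Lemma adapted_triangle z x y : N (x - y) <= N (x - z) + N (z - y).
Proof. by apply: le_trans (ND _ _); rewrite addrA subrK. Qed.

Lemma adapted_contract_pow k x : N (invmx A ^+ k *m x) <= th ^+ k * N x.
Proof.
elim: k => [|k IH]; first by rewrite !expr0 mul1mx mul1r.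
rewrite exprS -mulmxE -mulmxA exprS -mulrA; apply: le_trans (Ncontract _) _.
by rewrite ler_wpM2l ?IH// ltW ?th0.
Qed.

Lemma adapted_lipschitz k : exists2 L, 0 < L & forall x, N (A ^+ k *m x) <= L * N x.
Proof.
pose S : R := \sum_i \sum_j `|(A ^+ k) i j|.
have S0 : 0 <= S by apply: sumr_ge0 => i _; apply: sumr_ge0.
have C0' := C0; exists (1 + C * S); first by rewrite ltr_wpDr// mulr_ge0// ltW.
move=> x; apply: le_trans (Nle _) _; rewrite mulrDl mul1r.
apply: ler_wpDl; first exact: adapted_ge0.
rewrite -mulrA ler_wpM2l ?(ltW C0')//; apply: le_trans (l1norm_mulmx _ _ _) _.
by rewrite ler_wpM2l ?Nge.
Qed.

Lemma invmx_powK k x : A ^+ k *m (invmx A ^+ k *m x) = x.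
Proof.
rewrite mulmxA mulmxE -exprMn_comm; last by rewrite /GRing.comm -!mulmxE mulmxV ?mulVmx.
by rewrite -mulmxE mulmxV// expr1n mul1mx.
Qed.

Lemma mx_powK k x : invmx A ^+ k *m (A ^+ k *m x) = x.
Proof.
rewrite mulmxA mulmxE -exprMn_comm; last by rewrite /GRing.comm -!mulmxE mulmxV ?mulVmx.
by rewrite -mulmxE mulVmx// expr1n mul1mx.
Qed.

Lemma contract_small (r e : R) : 0 <= r -> 0 < e -> exists k, th ^+ k * r < e.
Proof.
move=> r0 e0.
have [k hk] := expr_lt_eps th (e / (r + 1)) (ltW th0) th1
  ltac:(by rewrite divr_gt0// ltr_wpDl).
exists k; move: hk; rewrite ltr_pdivlMr ?ltr_wpDl//; apply: le_lt_trans.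
by rewrite ler_wpM2l ?exprn_ge0 ?(ltW th0)// lerDl.
Qed.

(** Closedness stated with balls of the adapted norm, the only form in which the
    topology enters the geometric arguments. *)
Definition Nclosed S :=
  forall x, ~ S x -> exists2 e, 0 < e & forall y, N (y - x) < e -> ~ S y.

Lemma Nclosed_has (T : eqType) (s : seq T) (F : T -> set 'cV[R]_d) :
  (forall t, t \in s -> Nclosed (F t)) ->
  Nclosed [set x | exists2 t, t \in s & F t x].
Proof.
elim: s => [|t s IH] cF x nx; first by exists 1 => // y _ [].
have [||e e0 he] := IH _ x.
- by move=> u us; apply: cF; rewrite inE us orbT.
- by move=> [u us Fu]; apply: nx; exists u; rewrite // inE us orbT.
have [|e' e'0 he'] := cF t (mem_head _ _) x.
  by move=> Ft; apply: nx; exists t; rewrite // mem_head.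
exists (Num.min e e'); first by rewrite lt_min e0.
move=> y; rewrite lt_min => /andP[ye ye'] [u]; rewrite inE => /predU1P[->|us] Fu.
  exact: he' ye' Fu.
by apply: he ye _; exists u.
Qed.

Lemma Nclosed_forall (T : Type) (F : T -> set 'cV[R]_d) :
  (forall t, Nclosed (F t)) -> Nclosed [set x | forall t, F t x].
Proof.
move=> cF x /existsNP[t /cF[e e0 he]]; exists e => // y /he nF Fy.
exact/nF/Fy.
Qed.

Lemma Nclosed_ball k c r : Nclosed [set x | N (A ^+ k *m x - c) <= r].
Proof.
move=> x /negP; rewrite -ltNge => xr; have [L L0 hL] := adapted_lipschitz k.
exists ((N (A ^+ k *m x - c) - r) / L); first by rewrite divr_gt0// subr_gt0.
move=> y; rewrite ltr_pdivlMr// => xy; apply/negP; rewrite -ltNge.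
have := adapted_triangle (A ^+ k *m y) (A ^+ k *m x) c.
rewrite [N (A ^+ k *m x - A ^+ k *m y)]adapted_sym -mulmxBr.
have := hL (y - x); lra.
Qed.

Lemma Nclosed_translate S v : Nclosed S -> Nclosed (translate S v).
Proof.
move=> cS x nx; have [|e e0 he] := cS (x - v).
  by move=> Sx; apply: nx; exists (x - v); rewrite // subrK.
exists e => // y yx [z Sz zy]; apply: (he z) => //.
by rewrite (_ : z - _ = y - x)// -zy opprB addrA.
Qed.

Lemma nbhs_adaptedP x S :
  nbhs x S <-> exists2 e, 0 < e & forall y, N (y - x) < e -> S y.
Proof.
split.
  move=> /nbhs_ballP[e /= e0 he]; exists e => // y xy; apply: he; split=> // i j.
  rewrite ord1 -ball_normE /= distrC.
  apply: le_lt_trans (le_trans _ (Nge (y - x))) xy.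
  by apply: le_trans (ler_coord_l1norm _ _ i); rewrite !mxE.
move=> [e e0 he]; apply/nbhs_ballP; have C0' := C0.
exists (e / (C * d.+1%:R)); first by rewrite /= divr_gt0// mulr_gt0.
move=> y [_ xy]; apply: he; apply: le_lt_trans (Nle _) _.
have /(ler_wpM2l (ltW C0')) : l1norm (y - x) <= \sum_(i < d) (e / (C * d.+1%:R)).
  apply: ler_sum => i _; rewrite !mxE distrC.
  by have := xy i 0; rewrite -ball_normE /= => /ltW.
move=> /le_lt_trans; apply.
rewrite sumr_const card_ord -[_ / _ *+ d]mulr_natr mulrCA mulrAC.
by rewrite ltr_pdivrMr ?mulr_gt0// !ltr_pM2l// ltr_nat.
Qed.

Lemma Nclosed_closed S : Nclosed S <-> closed S.
Proof.
split=> [cS|cS x nx].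
  rewrite -[S]setCK; apply: open_closedC; rewrite openE => x nx.
  by apply/nbhs_adaptedP; exact: cS.
have := closed_openC cS; rewrite openE => /(_ _ nx) /nbhs_adaptedP.
by case=> e e0 he; exists e.
Qed.

Lemma compact_Nbounded S : compact S ->
  exists2 r, 0 <= r & forall x, S x -> N x <= r.
Proof.
move=> /compact_bounded[M [_ hM]].
have {}hM x : S x -> `|x| <= `|M| + 1 by apply: hM; rewrite ltr_pwDr// ler_norm.
have C0' := C0.
exists (C * \sum_(i < d) (`|M| + 1)).
  by rewrite mulr_ge0 ?(ltW C0')// sumr_ge0// => i _; rewrite addr_ge0.
move=> x Sx; apply: le_trans (Nle x) _; rewrite ler_wpM2l ?(ltW C0')//.
apply: ler_sum => i _; apply: le_trans (hM x Sx).
rewrite -[leRHS]/(mx_norm x) mx_normrE; apply/bigmax_geP; right => /=.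
by exists (i, 0).
Qed.

Lemma compact_Nclosed S : compact S -> Nclosed S.
Proof.
move=> cS; apply/Nclosed_closed.
exact: compact_closed (@norm_hausdorff R 'cV[R]_d) cS.
Qed.

Lemma Nclosed_bounded_compact S r : Nclosed S -> (forall x, S x -> N x <= r) -> compact S.
Proof.
move=> /Nclosed_closed cS hr.
have : compact [set v : 'rV[R]_d | forall i, `[- r, r]%classic (v ord0 i)].
  by apply: (@rV_compact _ _ (fun=> `[- r, r]%classic)) => _; exact: segment_compact.
move=> /(continuous_compact (f := @trmx R 1 d)) H.
have {}H : compact [set trmx v | v in [set v : 'rV[R]_d |
    forall i, `[- r, r]%classic (v ord0 i)]].
  apply: H; apply: continuous_subspaceT => v S' [P nP PS].
  exists (fun i j => P j i) => [i j|w wP]; first by have := nP j i; rewrite mxE.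
  by apply: PS => i j; rewrite mxE.
apply: subclosed_compact cS H _ => x Sx; exists x^T; last exact: trmxK.
move=> i /=; rewrite mxE in_itv /= -ler_norml.
exact: le_trans (ler_coord_l1norm _ _ _) (le_trans (Nge _) (hr _ Sx)).
Qed.

(** Nested nonempty compact sets have a common point: a cluster point of any
    choice of elements. *)
Lemma cluster_Nclosed (F : nat -> set 'cV[R]_d) (u : nat -> 'cV[R]_d) r :
  (forall k, Nclosed (F k)) -> (forall k m, (k <= m)%N -> F k (u m)) ->
  (forall x, F 0%N x -> N x <= r) ->
  exists x, forall k, F k x.
Proof.
move=> cF Fu Fr.
have cpt := Nclosed_bounded_compact _ r (cF 0%N) Fr.
have [|x [F0x clx]] := cpt (u @ \oo) _; first by exists 0%N => // m _; exact: Fu.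
exists x => k; apply: (Nclosed_closed _).1 (cF k) _ _ => B nB.
by apply: clx nB; exists k => // m km; exact: Fu.
Qed.

End AdaptedNorm.

(** * Finite box covers and Lebesgue measure *)

Section BoxCovers.
Context {R : realType} {d : nat}.
Implicit Types (E : set 'cV[R]_d) (a : R).

Lemma box_volume_ge0 (b : 'cV[R]_d * 'cV[R]_d) : 0 <= box_volume b.
Proof. by apply: prodr_ge0 => i _; rewrite le_max lexx. Qed.

(** E has outer Jordan content at most a.  All the upper bounds on measures come
    from finite covers, which can be concatenated and translated. *)
Definition finitely_boxed E a : Prop :=
  exists2 bs : seq ('cV[R]_d * 'cV[R]_d),
    (forall x, E x -> exists2 b, b \in bs & box b x) &
    \sum_(b <- bs) box_volume b <= a.

Lemma finitely_boxed_lebesgue E a :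
  (0 < d)%N -> finitely_boxed E a -> (lebesgue E <= a%:E)%E.
Proof.
move=> d0 [bs Ebs bsa].
have v0 : box_volume ((0, 0) : 'cV[R]_d * 'cV[R]_d) = 0.
  by rewrite /box_volume (bigD1 (Ordinal d0))//= mxE subr0 maxxx mul0r.
pose F k := nth (0, 0) bs k.
apply: (@le_trans _ _ (\sum_(0 <= k <oo) (box_volume (F k))%:E)%E).
  apply: ereal_inf_lbound; exists F => // x /Ebs[b bbs bx].
  by exists (index b bs) => //; rewrite /F nth_index.
have Fge0 k : (0%R <= (box_volume (F k))%:E)%E by rewrite lee_fin box_volume_ge0.
rewrite (nneseries_split 0 (size bs))//= add0n.
rewrite [X in (_ + X)%E]eseries0 ?adde0; last first.
  by move=> k sk _; rewrite /F nth_default// v0.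
rewrite sumEFin lee_fin; apply: le_trans bsa.
by rewrite (big_nth (0, 0)).
Qed.

Lemma finitely_boxedS E E' a a' : E `<=` E' -> a' <= a ->
  finitely_boxed E' a' -> finitely_boxed E a.
Proof.
move=> EE' aa' [bs bsE bsa]; exists bs; last exact: le_trans bsa aa'.
by move=> x /EE' /bsE.
Qed.

Lemma finitely_boxed_translate E a v :
  finitely_boxed E a -> finitely_boxed (translate E v) a.
Proof.
move=> [bs Ebs bsa]; exists [seq (b.1 + v, b.2 + v) | b <- bs].
  move=> _ [x /Ebs[b bbs bx] <-]; exists (b.1 + v, b.2 + v).
    by apply/mapP; exists b.
  by move=> i; rewrite /= !mxE lerD2r ltrD2r; exact: bx.
rewrite big_map; apply: le_trans bsa; apply: ler_sum => b _.
rewrite /box_volume /=; apply: ler_prod => i _.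
by rewrite !mxE opprD addrACA subrr addr0 lexx le_max lexx.
Qed.

Lemma finitely_boxed_bigcup (T : eqType) (s : seq T) (F : T -> set 'cV[R]_d)
    (a : T -> R) E :
  (forall x, E x -> exists2 z, z \in s & F z x) ->
  (forall z, z \in s -> finitely_boxed (F z) (a z)) ->
  finitely_boxed E (\sum_(z <- s) a z).
Proof.
elim: s E => [|z s IH] E Es Fs.
  by exists [::]; [move=> x /Es[] | rewrite !big_nil].
have [||bs1 E1 b1] := IH [set x | exists2 z, z \in s & F z x].
- by [].
- by move=> w ws; apply: Fs; rewrite inE ws orbT.
have [bs2 E2 b2] := Fs z (mem_head _ _).
exists (bs2 ++ bs1); last by rewrite big_cat big_cons lerD.
move=> x /Es[w]; rewrite inE => /predU1P[->|ws] Fx.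
  by have [b bb bx] := E2 _ Fx; exists b; rewrite // mem_cat bb.
have [|b bb bx] := E1 x; first by exists w.
by exists b; rewrite // mem_cat bb orbT.
Qed.

End BoxCovers.

Section Grid.
Context {R : realType} {d : nat}.
Variables (a M : nat).
Hypothesis M0 : (0 < M)%N.

Definition grid_index : finType := {ffun 'I_d -> 'I_(2 * a * M)}.

(** The half-open cubes of side 1 / M that partition the cube ]-a, a]^d. *)
Definition grid_cell (g : grid_index) : 'cV[R]_d * 'cV[R]_d :=
  (\col_i (- a%:R + (g i)%:R / M%:R), \col_i (- a%:R + (g i).+1%:R / M%:R)).

Let MR : 0 < M%:R :> R. Proof. by rewrite ltr0n. Qed.

Lemma card_grid_index : #|grid_index| = ((2 * a * M) ^ d)%N.
Proof. by rewrite card_ffun !card_ord. Qed.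

Lemma grid_cell_volume g : box_volume (grid_cell g) = M%:R^-1 ^+ d.
Proof.
rewrite /box_volume -[in RHS](card_ord d) -prodr_const.
apply: eq_bigr => i _; rewrite !mxE.
have -> : - a%:R + (g i).+1%:R / M%:R - (- a%:R + (g i)%:R / M%:R) = M%:R^-1 :> R.
  by rewrite -natr1 mulrDl; lra.
by rewrite max_r// invr_ge0 ltW.
Qed.

Lemma grid_cell_dist g (x y : 'cV[R]_d) i :
  box (grid_cell g) x -> box (grid_cell g) y -> `|x i 0 - y i 0| <= M%:R^-1.
Proof.
move=> /(_ i) + /(_ i); rewrite !mxE -natr1 mulrDl div1r => /andP[x1 x2] /andP[y1 y2].
rewrite ler_norml; apply/andP; split; lra.
Qed.

Lemma grid_cell_cover (x : 'cV[R]_d) :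
  (forall i, - a%:R < x i 0 <= a%:R) -> exists g, box (grid_cell g) x.
Proof.
move=> hx.
have /choice[g hg] : forall i, exists g : 'I_(2 * a * M),
    - a%:R + g%:R / M%:R < x i 0 <= - a%:R + g.+1%:R / M%:R.
  move=> i; have /andP[x1 x2] := hx i.
  set y := (x i 0 + a%:R) * M%:R.
  have y0 : 0 < y by rewrite /y mulr_gt0//; lra.
  have yle : y <= (2 * a * M)%:R.
    rewrite /y !natrM; apply: ler_wpM2r; first exact: ltW.
    lra.
  have ex : exists n : nat, y <= n%:R by exists (2 * a * M)%N.
  have [n yn nmin] := ex_minnP ex.
  case: n yn nmin => [|n yn nmin]; first by rewrite leNgt y0.
  have nlt : (n < 2 * a * M)%N by exact: nmin.
  have ny : n%:R < y.
    by rewrite ltNge; apply/negP => /nmin; rewrite ltnn.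
  exists (Ordinal nlt) => /=.
  move: ny yn; rewrite /y -ltr_pdivrMr// -[_ * M%:R <= _]ler_pdivlMr//.
  by move=> ny yn; apply/andP; split; lra.
exists [ffun i => g i] => i; rewrite !mxE ffunE; exact: hg.
Qed.

End Grid.

Section LowerBound.
Context {R : realType} {d : nat}.

Lemma prod_enlarge (l : 'I_d -> R) (e : R) : 0 < e ->
  exists2 t, 0 < t & \prod_i (l i + 3 * t) <= \prod_i l i + e.
Proof.
move=> e0.
pose p : {poly R} := \prod_i ((l i)%:P + 'X).
have pE t : p.[t] = \prod_i (l i + t).
  by rewrite horner_prod; apply: eq_bigr => i _; rewrite !hornerE.
have /cvgrPdist_lt/(_ e e0) := @continuous_horner _ p 0.
move=> [r /= r0 hr].
exists (r / 6); first by rewrite divr_gt0.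
have := hr (3 * (r / 6)); rewrite /= sub0r normrN ger0_norm; last first.
  by rewrite mulr_ge0// divr_ge0// ltW.
move=> /(_ ltac:(lra)); rewrite !pE.
have -> : \prod_i (l i + 0) = \prod_i l i by apply: eq_bigr => i; rewrite addr0.
by rewrite distrC => /ltr_distlDr; lra.
Qed.

Lemma count_interval (m : nat) (u v x h L : R) : 0 < h -> 0 <= L -> v - u <= L ->
  h * #|[pred g : 'I_m | u < x + h * g%:R < v]|%:R <= L + h.
Proof.
move=> h0 L0 uvL; set S := [pred g | _].
have [g0 Sg0|S0] := pickP S; last first.
  by rewrite (eq_card0 S0) mulr0 addr_ge0// ltW.
pose g1 := [arg min_(g < g0 | S g) val g]%N.
pose g2 := [arg max_(g > g0 | S g) val g]%N.
have [Sg1 min1] : S g1 /\ forall g, S g -> (g1 <= g)%N.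
  by rewrite /g1; case: arg_minnP.
have [Sg2 max2] : S g2 /\ forall g, S g -> (g <= g2)%N.
  by rewrite /g2; case: arg_maxnP.
have cardS : (#|S| <= (g2 - g1).+1)%N.
  rewrite -[X in (_ <= X)%N]card_ord.
  apply: (@leq_card_in _ _ (fun g : 'I_m => inord (g - g1) : 'I_(g2 - g1).+1)).
  move=> g g' Sg Sg' /(congr1 val) /=; rewrite !inordK ?ltnS ?leq_sub2r ?max2//.
  move=> /(congr1 (addn g1)); rewrite !subnKC ?min1// => /val_inj//.
apply: le_trans (_ : h * (g2 - g1).+1%:R <= _).
  by rewrite ler_wpM2l ?ler_nat// ltW.
rewrite -natr1 natrB ?min1// mulrDr mulr1 mulrBr lerD2r.
move: Sg1 Sg2 => /andP[? ?] /andP[? ?]; lra.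
Qed.

(** A countable cover by boxes is enlarged to open boxes at an arbitrarily small
    cost in volume, and compactness leaves finitely many of them.  Each contains, of
    the points of a fine lattice of step h, at most the product over the coordinates
    of (length / h + 1), while the cube contains m ^ d lattice points: comparing the
    two counts bounds the total volume from below. *)
Lemma lebesgue_cube_ge (K : set 'cV[R]_d) (c : 'cV[R]_d) (eta : R) :
  compact K -> 0 < eta ->
  (forall x : 'cV[R]_d, (forall i, `|x i 0 - c i 0| <= eta) -> K x) ->
  (((2 * eta) ^+ d)%:E <= lebesgue K)%E.
Proof.
move=> cK eta0 QK; apply/ereal_infP => _ [F KF <-].
apply/lee_addgt0Pr => e e0.
have vol0 k : (0%R <= (box_volume (F k))%:E)%E by rewrite lee_fin box_volume_ge0.
apply: le_trans (epsilon_trick xpredT vol0 (ltW e0)).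
pose l k i : R := Num.max 0 ((F k).2 i 0 - (F k).1 i 0).
have l0 k i : 0 <= l k i by rewrite le_max lexx.
have /choice[t /all_and2[t0 ht]] : forall k, exists t, 0 < t /\
    \prod_i (l k i + 3 * t) <= box_volume (F k) + e / (2 ^ k.+1)%:R.
  move=> k; have [] := prod_enlarge (l k) (e / (2 ^ k.+1)%:R).
    by rewrite divr_gt0// ltr0n expn_gt0.
  by move=> t; exists t.
pose U k : set 'cV[R]_d := [set x | forall i,
  (F k).1 i 0 - t k < x i 0 < (F k).2 i 0 + t k].
have oU k : open (U k).
  rewrite openE => x Ux; apply/nbhs_ballP.
  have /choice[r /all_and2[r0 hr]] : forall i, exists r, 0 < r /\
      forall y : R, `|x i 0 - y| < r -> (F k).1 i 0 - t k < y < (F k).2 i 0 + t k.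
    move=> i; have /andP[? ?] := Ux i.
    exists (Num.min (x i 0 - ((F k).1 i 0 - t k)) ((F k).2 i 0 + t k - x i 0)).
    split; first by rewrite lt_min; apply/andP; split; lra.
    move=> y; rewrite lt_min => /andP[]; rewrite !ltr_norml.
    by move=> /andP[? ?] /andP[? ?]; apply/andP; split; lra.
  exists (\big[Num.min/1]_i r i).
    by apply: lt_bigmin => [|i _]; [exact: ltr01|exact: r0].
  move=> y [_ /(_ _ 0) xy] i; apply: hr.
  have := xy i; rewrite -ball_normE /= => /lt_le_trans; apply.
  exact: bigmin_le.
have KU : K `<=` cover setT U.
  move=> x /KF[k _ Fx]; exists k => // i; have /andP[? ?] := Fx i.
  by have := t0 k => tk; apply/andP; split; lra.
move: cK; rewrite compact_cover => /(_ _ _ _ (fun k _ => oU k) KU)[D' _ KD'].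
pose n := (\max_(k <- D') k).+1.
have Kn x : K x -> exists2 k, (k < n)%N & U k x.
  move=> /KD'[k kD Ux]; exists k => //; rewrite ltnS.
  exact: (@leq_bigmax_seq _ (enum_fset D') xpredT id k).
apply: le_trans (nneseries_lim_ge n _); last first.
  move=> k _ _; rewrite adde_ge0// lee_fin divr_ge0//; exact: ltW.
rewrite sumEFin lee_fin big_mkord.
apply: le_trans (_ : \sum_(k < n) \prod_i (l k i + 3 * t k) <= _); last first.
  by apply: ler_sum => k _; exact: ht.
(* the lattice step must be below every margin t k, for the + 1 in the counts *)
pose tm := \big[Num.min/1]_(k < n) t k.
have tm0 : 0 < tm by apply: lt_bigmin => [|i _]; [exact: ltr01|exact: t0].
have [m m0 mt] : exists2 m : nat, (0 < m)%N & 2 * eta / m%:R <= tm.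
  have q0 : 0 <= 2 * eta / tm by apply/divr_ge0; apply/ltW => //; rewrite mulr_gt0.
  have := archi_boundP q0; set m := Num.bound _ => hm.
  have m0 : 0 < m%:R :> R by exact: le_lt_trans hm.
  exists m; first by rewrite -(ltr0n R).
  by rewrite ler_pdivrMr// [tm * _]mulrC -ler_pdivrMr// ltW.
have mR : 0 < m%:R :> R by rewrite ltr0n.
pose h := 2 * eta / m%:R.
have h0 : 0 < h by rewrite divr_gt0// mulr_gt0.
pose pt (g : {ffun 'I_d -> 'I_m}) : 'cV[R]_d :=
  \col_i (c i 0 - eta + h * (g i)%:R).
have ptK g : K (pt g).
  apply: QK => i; rewrite mxE.
  have g0 : 0 <= h * (g i)%:R by rewrite mulr_ge0// ltW.
  have g1 : h * (g i)%:R <= 2 * eta.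
    rewrite /h mulrAC ler_pdivrMr// ler_wpM2l ?ler_nat//; last exact: ltnW.
    by rewrite mulr_ge0// ltW.
  by rewrite ler_norml; apply/andP; split; lra.
pose S (k : 'I_n) i : pred 'I_m := [pred g : 'I_m |
  (F k).1 i 0 - t k < c i 0 - eta + h * g%:R < (F k).2 i 0 + t k].
have count : (m ^ d <= \sum_(k < n) \prod_i #|S k i|)%N.
  have <- : #|{ffun 'I_d -> 'I_m}| = (m ^ d)%N by rewrite card_ffun !card_ord.
  apply: (@leq_trans (\sum_(k < n) #|[pred g : {ffun 'I_d -> 'I_m} |
      [forall i, S k i (g i)]]|)%N).
    rewrite -sum1_card; under [X in (_ <= X)%N]eq_bigr do rewrite -sum1_card big_mkcond.
    rewrite exchange_big /=; apply: leq_sum => g _.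
    have [k kn Uk] := Kn _ (ptK g).
    rewrite (bigD1 (Ordinal kn))//= ifT ?leq_addr//.
    apply/forallP => i; have := Uk i; by rewrite mxE.
  apply: leq_sum => k _.
  apply: eq_leq; transitivity #|(family (S k) : pred {ffun 'I_d -> 'I_m})|.
    by apply: eq_card => g; rewrite [LHS]inE; apply/forallP/familyP.
  by rewrite card_family foldrE big_image.
have -> : (2 * eta) ^+ d = h ^+ d * (m ^ d)%:R.
  by rewrite natrX -exprMn /h divfK// gt_eqF.
apply: le_trans (_ : h ^+ d * (\sum_(k < n) \prod_i #|S k i|)%:R <= _).
  by rewrite ler_wpM2l ?ler_nat// exprn_ge0// ltW.
rewrite natr_sum mulr_sumr; apply: ler_sum => k _.
rewrite natr_prod -[X in h ^+ X](card_ord d) -prodr_const -big_split /=.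
apply: ler_prod => i _; rewrite mulr_ge0 ?(ltW h0)//=.
have tk := t0 k; have htk : h <= t k by apply: le_trans mt _; exact: bigmin_le.
have := count_interval m ((F k).1 i 0 - t k) ((F k).2 i 0 + t k) (c i 0 - eta)
  h (l k i + 2 * t k) h0.
have lk : (F k).2 i 0 - (F k).1 i 0 <= l k i by rewrite le_max lexx orbT.
have := l0 k i => ? /(_ ltac:(lra) ltac:(lra)) /le_trans; apply; lra.
Qed.

End LowerBound.

(** * Weak uniform discreteness bounds finite configurations *)

Section LocalFiniteness.
Context {R : realType} {d : nat}.
Implicit Types (x y c : 'cV[R]_d) (Y : multiset R d).

Lemma enorm_le_l1norm x : enorm x <= l1norm x.
Proof.
have : \sum_i x i 0 ^+ 2 <= l1norm x ^+ 2.
  rewrite expr2 {1}/l1norm mulr_suml ler_sum// => i _.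
  by rewrite -[_ ^+ 2]ger0_norm ?sqr_ge0// normrX expr2 ler_wpM2l// ler_coord_l1norm.
by rewrite -ler_sqrt ?sqr_ge0// sqrtr_sqr ger0_norm// l1norm_ge0.
Qed.

Lemma ler_coord_enorm x i : `|x i 0| <= enorm x.
Proof.
rewrite -sqrtr_sqr ler_sqrt ?sumr_ge0// => [|j _]; last exact: sqr_ge0.
by rewrite (bigD1 i)//= lerDl sumr_ge0// => j _; exact: sqr_ge0.
Qed.

Lemma l1norm_le_enorm x : l1norm x <= d%:R * enorm x.
Proof.
apply: le_trans (_ : \sum_(i < d) enorm x <= _).
  by apply: ler_sum => i _; exact: ler_coord_enorm.
by rewrite sumr_const card_ord mulr_natl.
Qed.

Lemma discrete_with_seq r m Y c (s : seq 'cV[R]_d) : discrete_with r m Y ->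
  uniq s -> (forall x, x \in s -> enorm (x - c) < r) -> (\sum_(x <- s) Y x <= m)%N.
Proof.
move=> hY us sr; have := hY c; rewrite /mscount => /(le_trans _) H.
rewrite -(ler_nat R) -lee_fin; apply: H; apply: esum_ge; exists [set` s].
  by split; [exact: finite_seq | move=> x /= /sr].
by rewrite -fsbig_seq// natr_sum -sumEFin.
Qed.

(** A lower bound on the distances, expressed without a distance: two points of
    the support in a common ball coincide. *)
Lemma discrete_with1 r Y : (forall x, (Y x <= 1)%N) ->
  (forall c x y, (0 < Y x)%N -> (0 < Y y)%N ->
    enorm (x - c) < r -> enorm (y - c) < r -> x = y) ->
  discrete_with r 1 Y.
Proof.
move=> Y1 Ysep c; apply: ge_ereal_sup => _ [F [finF Fr] <-].
rewrite fsbig_finite//= sumEFin -natr_sum lee_fin ler_nat.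
have Fin x : x \in fset_set F -> enorm (x - c) < r.
  by rewrite in_fset_set// inE => /Fr.
have [/hasP[x xF Yx]|/hasPn h] := boolP (has (fun x => 0 < Y x)%N (fset_set F)).
  rewrite (bigD1_seq x) ?fset_uniq//= big1_seq ?addn0// => y /andP[yx yF].
  apply/eqP; rewrite eqn0Ngt; apply/negP => Yy.
  by rewrite (Ysep c x y) ?eqxx ?Fin// in yx.
by rewrite big1_seq// => y /= /h; rewrite lt0n negbK => /eqP.
Qed.

(** A ball of any radius is covered by a fixed number of grid cells so small that
    weak uniform discreteness applies to each of them. *)
Lemma weakly_uniformly_discrete_bounded Y (rho : R) :
  weakly_uniformly_discrete Y -> exists B, forall c (s : seq 'cV[R]_d), uniq s ->
  (forall x, x \in s -> (0 < Y x)%N /\ l1norm (x - c) <= rho) -> (size s <= B)%N.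
Proof.
move=> [r [m [r0 _ hY]]].
have [M M0 Mr] : exists2 M, (0 < M)%N & d%:R / M%:R < r.
  have q0 : 0 <= d%:R / r by rewrite divr_ge0// ltW.
  have := archi_boundP q0; set M := Num.bound _ => hM.
  have M0 : 0 < M%:R :> R by exact: le_lt_trans hM.
  exists M; first by rewrite -(ltr0n R).
  by rewrite ltr_pdivrMr// [r * _]mulrC -ltr_pdivrMr.
pose a := Num.bound `|rho|.
have rhoa : rho < a%:R by apply: le_lt_trans (ler_norm _) (archi_boundP _).
exists (\sum_(g : @grid_index d a M) m)%N => c s us hs.
apply: (@leq_trans (\sum_(g : @grid_index d a M)
    \sum_(x <- s) `[< box (grid_cell a M g) (x - c)%R >])%N).
  rewrite exchange_big -sum1_size !big_seq; apply: leq_sum => x xs.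
  have [|g gx] := @grid_cell_cover R d a M M0 (x - c).
    move=> i; have [_ xr] := hs x xs.
    have := le_lt_trans (le_trans (ler_coord_l1norm _ _ i) xr) rhoa.
    by rewrite ltr_norml => /andP[-> /ltW ->].
  by rewrite (bigD1 g)//= asboolT.
apply: leq_sum => g _.
rewrite -[m]mul1n.
pose s' := [seq x <- s | `[< box (grid_cell a M g) (x - c)%R >]].
have -> : (\sum_(x <- s) `[< box (grid_cell a M g) (x - c)%R >] = size s')%N.
  rewrite size_filter -sum1_count [RHS]big_mkcond /=.
  by apply: eq_bigr => x _; case: asboolP.
rewrite mul1n; case s'E : s' => [//|y s'']; rewrite -s'E.
have ys' : y \in s' by rewrite s'E mem_head.
have us' : uniq s' by exact: filter_uniq.
apply: leq_trans (discrete_with_seq _ _ _ y s' hY us' _).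
  rewrite -sum1_size big_seq [X in (_ <= X)%N]big_seq; apply: leq_sum => x.
  by rewrite mem_filter => /andP[_ /hs[]].
move=> x; move: ys'; rewrite !mem_filter => /andP[/asboolP yg _] /andP[/asboolP xg _].
apply: le_lt_trans (enorm_le_l1norm _) _; apply: le_lt_trans Mr.
apply: le_trans (_ : \sum_(i < d) M%:R^-1 <= _).
  apply: ler_sum => i _; rewrite !mxE.
  have := grid_cell_dist _ _ g _ _ i xg yg; rewrite !mxE.
  by rewrite opprB addrA subrK.
by rewrite sumr_const card_ord mulr_natl.
Qed.

End LocalFiniteness.

(** A list of maximal length, among the duplicate-free lists of elements of P. *)
Lemma bounded_enumeration (T : eqType) (P : T -> Prop) B :
  (forall s : seq T, uniq s -> (forall t, t \in s -> P t) -> (size s <= B)%N) ->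
  exists s : seq T, forall t, t \in s <-> P t.
Proof.
move=> hB; suff : forall b (s : seq T), uniq s -> (forall t, t \in s -> P t) ->
    (B <= size s + b)%N -> exists s : seq T, forall t, t \in s <-> P t.
  by move=> /(_ B [::]); apply.
have grow s t : (forall t, t \in s -> P t) -> P t -> forall u, u \in t :: s -> P u.
  by move=> sP Pt u; rewrite inE => /predU1P[->|/sP].
elim=> [|b IH] s us sP sB.
  exists s => t; split=> [|Pt]; first exact: sP.
  apply: contrapT => /negP ts; have := hB (t :: s).
  rewrite /= ts us => /(_ isT (grow _ _ sP Pt)).
  by rewrite leqNgt ltnS -[X in (_ <= X)%N]addn0 sB.
have [[t Pt ts]|H] := pselect (exists2 t, P t & t \notin s).
  apply: (IH (t :: s)); rewrite /= ?ts//; last by rewrite addSnnS.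
  exact: grow.
exists s => t; split=> [|Pt]; first exact: sP.
by apply: contrapT => /negP ts; apply: H; exists t.
Qed.

(** * The descendants of a vertex *)

Section Descent.
Context {R : realType} {d n : nat}.
Variables (A : 'M[R]_d) (D : 'I_n -> 'I_n -> {fset 'cV[R]_d}).
Notation vertex := ('cV[R]_d * 'I_n)%type.
Implicit Types (v w u : vertex) (s : seq vertex) (x y : 'cV[R]_d).

Definition children v : seq vertex :=
  flatten [seq [seq (A *m v.1 + e, j) | e <- D j v.2] | j <- enum 'I_n].

Definition offspring s : seq vertex := flatten [seq children v | v <- s].

(** Lists keep multiplicities: as a multiset, [desc k v] is the k-th inflation of
    the single point v, each descendant being counted once for every path from v. *)
Definition desc k v : seq vertex := iter k offspring [:: v].

Lemma childrenP v w :
  reflect (exists2 e, e \in D w.2 v.2 & w.1 = A *m v.1 + e) (w \in children v).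
Proof.
apply: (iffP flatten_mapP) => [[j _ /mapP[e eD ->]]|[e eD w1]].
  by exists e.
exists w.2; first by rewrite mem_enum.
by apply/mapP; exists e => //; rewrite -w1; case: w {eD w1}.
Qed.

Lemma offspring_cat s1 s2 : offspring (s1 ++ s2) = offspring s1 ++ offspring s2.
Proof. by rewrite /offspring map_cat flatten_cat. Qed.

Lemma iter_offspring k s : iter k offspring s = flatten [seq desc k v | v <- s].
Proof.
elim: s => [|v s IH] /=; first by elim: k => //= k ->.
rewrite -IH -cat1s; elim: k {IH} => //= k ->.
by rewrite offspring_cat.
Qed.

Lemma descD k m v : desc (k + m) v = flatten [seq desc m w | w <- desc k v].
Proof. by rewrite addnC /desc iterD iter_offspring. Qed.

Lemma mem_descD k m v w :
  reflect (exists2 u, u \in desc k v & w \in desc m u) (w \in desc (k + m) v).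
Proof. by rewrite descD; apply: flatten_mapP. Qed.

Lemma desc_one v : desc 1 v = children v.
Proof. by rewrite /desc /= /offspring /= cats0. Qed.

Lemma descS k v : desc k.+1 v = flatten [seq desc k w | w <- children v].
Proof. by rewrite -desc_one -descD add1n. Qed.

Lemma mem_descS k v w :
  reflect (exists2 u, u \in desc k v & w \in children u) (w \in desc k.+1 v).
Proof. exact: flatten_mapP. Qed.

Definition shift_vertex x v : vertex := (v.1 + x, v.2).

Lemma shift_vertex_inj x : injective (shift_vertex x).
Proof. by move=> [y i] [z j] [/addIr -> ->]. Qed.

Lemma children_shift x v :
  children (shift_vertex x v) = map (shift_vertex (A *m x)) (children v).
Proof.
rewrite /children map_flatten -[X in _ = flatten X]map_comp; congr flatten.
apply: eq_map => j /=; rewrite -[RHS]map_comp; apply: eq_map => e /=.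
by rewrite /shift_vertex /= mulmxDr addrAC.
Qed.

(** Inflation commutes with translations up to applying the matrix to the
    translation vector, so that every configuration below a vertex reappears below
    every vertex of the same type. *)
Lemma desc_shift k x v :
  desc k (shift_vertex x v) = map (shift_vertex (A ^+ k *m x)) (desc k v).
Proof.
elim: k => [|k IH] /=; first by rewrite expr0 mul1mx.
rewrite IH /offspring map_flatten -[in RHS]map_comp -map_comp; congr flatten.
by apply: eq_map => w /=; rewrite children_shift mulmxA exprS.
Qed.

Lemma desc_origin k x i :
  desc k (x, i) = map (shift_vertex (A ^+ k *m x)) (desc k (0, i)).
Proof. by rewrite -desc_shift /shift_vertex /= add0r. Qed.

Definition type_count (j : 'I_n) s : nat := count (fun w => w.2 == j) s.

Lemma type_count_shift j x s :
  type_count j (map (shift_vertex x) s) = type_count j s.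
Proof. by rewrite /type_count count_map; apply: eq_count. Qed.

Lemma count_children (p : pred vertex) v :
  count p (children v) = (\sum_j \sum_(e <- D j v.2) p ((A *m v.1 + e)%R, j))%N.
Proof.
rewrite count_flatten sumnE big_map big_map big_enum /=.
apply: eq_bigr => j _; rewrite count_map -sum1_count big_mkcond.
by apply: eq_bigr => e _ /=; case: (p _).
Qed.

Lemma type_count_children j v : type_count j (children v) = #|` D j v.2|%fset.
Proof.
rewrite /type_count count_children (bigD1 j)//= [X in (_ + X)%N]big1 => [|l lj].
  by rewrite addn0 eqxx sum1_size.
by rewrite big1// => e _; rewrite (negbTE lj).
Qed.

(** Powers of the subdivision matrix count paths. *)
Lemma type_count_desc k j i x :
  (subdivision_matrix D ^+ k) j i = (type_count j (desc k (x, i)))%:R :> R.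
Proof.
elim: k j => [|k IH] j; first by rewrite expr0 mxE /= addn0 eq_sym.
rewrite exprS mxE /= /type_count count_flatten sumnE big_map big_map natr_sum.
under eq_bigr do rewrite mxE IH.
under [RHS]eq_bigr do rewrite -/(type_count _ _) type_count_children.
elim: (desc k (x, i)) => [|v s IHs]; first by rewrite big_nil big1// => l _; rewrite mulr0.
rewrite big_cons -IHs (bigD1 v.2)//= eqxx natrD mulrDr mulr1 -addrA.
congr (_ + _); rewrite [in RHS](bigD1 v.2)//=; congr (_ + _).
by apply: eq_bigr => l /negbTE; rewrite eq_sym => ->.
Qed.

(** This is the only form in which primitivity is used; the length is positive
    so that every vertex has a child. *)
Lemma type_reached (hS : primitive_mx (subdivision_matrix D : 'M[R]_n)) :
  exists2 k, (0 < k)%N & forall v j, exists2 w, w \in desc k v & w.2 = j.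
Proof.
case: hS => _ [k k0 Sk]; exists k => // -[x i] j.
have := Sk j i; rewrite (type_count_desc _ _ _ x) ltr0n /type_count -has_count.
by move=> /hasP[w wd /eqP]; exists w.
Qed.

Lemma desc_nonempty (hS : primitive_mx (subdivision_matrix D : 'M[R]_n)) k v :
  exists w, w \in desc k v.
Proof.
have [[//|m] _ hm] := type_reached hS.
elim: k => [|k [u uv]]; first by exists v; rewrite mem_head.
have [w + _] := hm u u.2; rewrite descS => /flatten_mapP[c cu _].
by exists c; apply/mem_descS; exists u.
Qed.

Definition family_of s : multiset_family R d n := fun j y => count_mem (y, j) s.

Hypothesis uA : A \in unitmx.

Lemma family_of_offspring s : family_of (offspring s) = inflation A D (family_of s).
Proof.
apply/funext => j; apply/funext => y; rewrite /family_of /inflation /msshift /mslin.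
rewrite count_flatten sumnE !big_map.
elim: s => [|v s IH].
  by rewrite big_nil big1// => l _; rewrite big1.
rewrite big_cons IH /=.
under [RHS]eq_bigr do rewrite big_split /=.
rewrite big_split /=; congr (_ + _)%N.
rewrite -/(count_mem _ _) count_children (bigD1 j)//=.
rewrite [X in (_ + X)%N]big1 ?addn0; last first.
  by move=> k kj; rewrite big1// => e _; rewrite xpair_eqE (negbTE kj) andbF.
rewrite (bigD1 v.2)//= [X in (_ + X)%N]big1 ?addn0; last first.
  move=> l lv; rewrite big1// => e _.
  by case: v lv => z i /= lv; rewrite xpair_eqE [i == l]eq_sym (negbTE lv) andbF.
apply: eq_bigr => e _ /=; rewrite xpair_eqE eqxx andbT; case: v => z i /=.
rewrite xpair_eqE eqxx andbT.
congr nat_of_bool; apply/eqP/eqP => [<-|->]; first by rewrite addrK mulKmx.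
by rewrite mulKVmx// subrK.
Qed.

Lemma inflation_mono (X Y : multiset_family R d n) :
  family_subset X Y -> family_subset (inflation A D X) (inflation A D Y).
Proof. by move=> XY j y; apply: leq_sum => l _; apply: leq_sum => e _; exact: XY. Qed.

Lemma family_of_iter_mono k s (X : multiset_family R d n) :
  inflation A D X = X -> family_subset (family_of s) X ->
  family_subset (family_of (iter k offspring s)) X.
Proof.
move=> XX sX; elim: k => //= k IH.
by rewrite family_of_offspring -XX; exact: inflation_mono.
Qed.

Lemma family_of_iter_sub k s s' : family_subset (family_of s) (family_of s') ->
  family_subset (family_of (iter k offspring s)) (family_of (iter k offspring s')).
Proof.
by move=> ss'; elim: k => //= k IH; rewrite !family_of_offspring; exact: inflation_mono.
Qed.

(** * Irreducible families with a loop: generation and simple multiplicities *)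

Section Irreducible.
Variable X : multiset_family R d n.
Hypothesis irr : irreducible_family A D X.
Variable v0 : vertex.
Hypothesis X0 : graph_vertex X v0.
Hypothesis loop_v0 : graph_edge A D v0 v0.
Let XX : inflation A D X = X. Proof. by case: irr. Qed.

Lemma family_of_vertex v : graph_vertex X v -> family_subset (family_of [:: v]) X.
Proof.
move=> Xv j y; rewrite /family_of /= addn0.
by case: eqP => //= vE; move: Xv; rewrite vE.
Qed.

Lemma loop_child : v0 \in children v0.
Proof. by move: loop_v0 => /hasP[e eD /eqP ve]; apply/childrenP; exists e. Qed.

Lemma family_of_desc_incr k m : (k <= m)%N ->
  family_subset (family_of (desc k v0)) (family_of (desc m v0)).
Proof.
move=> /subnK <-; rewrite addnC.
elim: (m - k)%N => [|l IH] j y; first by rewrite addn0.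
apply: leq_trans (IH j y) _; rewrite addnS.
rewrite [desc (k + l).+1 v0]/desc -[(k + l).+1]addn1 iterD.
apply: family_of_iter_sub => i x; rewrite /family_of /= addn0.
case: eqP => //= vE; rewrite -vE -has_count has_pred1 /offspring /= cats0.
exact: loop_child.
Qed.

Lemma desc_incr k m v : (k <= m)%N -> v \in desc k v0 -> v \in desc m v0.
Proof.
case: v => y j km; rewrite -!has_pred1 !has_count => h.
exact: leq_trans h (family_of_desc_incr _ _ km j y).
Qed.

Lemma bounded_stationary (f : nat -> nat) B : (forall k m, (k <= m)%N -> (f k <= f m)%N) ->
  (forall k, (f k <= B)%N) -> exists K, forall k, (K <= k)%N -> f k = f K.
Proof.
move=> fi fB; suff : forall b K, (B <= f K + b)%N ->
    exists K, forall k, (K <= k)%N -> f k = f K.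
  by move=> /(_ B 0%N); apply; apply: leq_addl.
elim=> [|b IH] K BK.
  exists K => k Kk; apply/eqP; rewrite eqn_leq (fi _ _ Kk) andbT.
  by apply: leq_trans (fB k) _; rewrite addn0 in BK.
have [[k Kk fk]|H] := pselect (exists2 k, (K <= k)%N & (f K < f k)%N).
  by apply: (IH k); rewrite (leq_trans BK)// addnS -addSn leq_add2r.
exists K => k Kk; apply/eqP; rewrite eqn_leq (fi _ _ Kk) andbT leqNgt.
by apply/negP => h; apply: H; exists k.
Qed.

(** The loop at v0 makes the descendants of v0 increase with the level.  They stay
    below X, so their multiplicities are eventually constant at each point, and the
    limit is a subfamily of X.  Since inflation reads off finitely many values, the
    limit is a fixed point, hence equal to X by irreducibility. *)
Lemma generated_vertex y j : exists k, family_of (desc k v0) j y = X j y.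
Proof.
have sub k : family_subset (family_of (desc k v0)) X.
  exact/family_of_iter_mono/family_of_vertex.
pose f (jy : 'I_n * 'cV[R]_d) k := family_of (desc k v0) jy.1 jy.2.
have /choice[K hK] : forall jy, exists K, forall k, (K <= k)%N -> f jy k = f jy K.
  move=> jy; apply: (@bounded_stationary (f jy) (X jy.1 jy.2)) => [k m km|k].
    exact: family_of_desc_incr.
  exact: sub.
pose Y : multiset_family R d n := fun j y => f (j, y) (K (j, y)).
have YX : Y = X.
  case: irr => _ _; apply.
  - exists v0.2, v0.1; rewrite /msupp /= /Y /f /=.
    apply: leq_trans (family_of_desc_incr 0 _ (leq0n _) _ _).
    by rewrite /family_of /= -surjective_pairing eqxx.
  - by move=> i x; exact: sub.
  apply/funext => i; apply/funext => x.
  (* a level at which all the values used by inflation at (x, i) are final *)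
  pose L := (\max_l \max_(e <- D i l) K (l, invmx A *m (x - e)))%N.
  pose M := maxn L (K (i, x)).
  have YM : Y i x = family_of (desc M.+1 v0) i x.
    by rewrite /Y -(hK (i, x) M.+1)// leqW// leq_maxr.
  rewrite YM [desc _ _]/= family_of_offspring.
  apply: eq_bigr => l _; apply: eq_big_seq => e eD.
  rewrite /mslin /Y -(hK (l, _) M) //.
  apply: leq_trans (leq_maxl _ _).
  apply: leq_trans (leq_bigmax l).
  exact: (@leq_bigmax_seq _ _ xpredT (fun e => K (l, invmx A *m (x - e)))).
by exists (K (j, y)); rewrite -YX.
Qed.

Lemma graph_vertex_desc k v w : graph_vertex X v -> w \in desc k v -> graph_vertex X w.
Proof.
move=> Xv wv; have := family_of_iter_mono k _ _ XX (family_of_vertex _ Xv) w.2 w.1.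
by apply: leq_trans; rewrite /family_of -surjective_pairing -has_count has_pred1.
Qed.

(** As the levels are nested, finitely many vertices descend from v0 at a common
    level.  The whole of a finite configuration in X can then be moved at once, by
    translating its ancestor v0. *)
Lemma generated_seq s : (forall v, v \in s -> graph_vertex X v) ->
  exists K, forall v, v \in s -> v \in desc K v0.
Proof.
elim: s => [|v s IH] sX; first by exists 0%N.
have [|K hK] := IH; first by move=> w ws; apply: sX; rewrite inE ws orbT.
have [k hk] := generated_vertex v.1 v.2.
exists (maxn K k) => w; rewrite inE => /predU1P[->|ws].
  apply: desc_incr (leq_maxr _ _) _; rewrite -has_pred1 has_count.
  by have := sX v (mem_head _ _); rewrite /graph_vertex -hk /family_of -surjective_pairing.
exact: desc_incr (leq_maxl _ _) (hK _ ws).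
Qed.

Lemma graph_vertex_parent w : graph_vertex X w ->
  exists2 v, graph_vertex X v & w \in children v.
Proof.
move=> Xw; have : (0 < inflation A D X w.2 w.1)%N by rewrite XX.
rewrite lt0n sum_nat_eq0 negb_forall => /existsP[l].
rewrite implyTb /msshift -lt0n.
move=> H; have : has (fun e => 0 < mslin A (X l) (w.1 - e)%R)%N (D w.2 l).
  apply: contraTT H => /hasPn H; rewrite -leqNgt leqn0; apply/eqP.
  by apply: big1_seq => e /= /H; rewrite lt0n negbK => /eqP.
move=> /hasP[e eD eX]; exists (invmx A *m (w.1 - e), l); first exact: eX.
by apply/childrenP; exists e => //=; rewrite mulKVmx// subrK.
Qed.

Lemma count_desc_mul k m v u w :
  (count_mem u (desc k v) * count_mem w (desc m u) <= count_mem w (desc (k + m) v))%N.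
Proof.
rewrite descD count_flatten sumnE !big_map.
elim: (desc k v) => [|z s IH] /=; first by rewrite mul0n.
rewrite big_cons mulnDl leq_add//.
by case: eqP => [->|_]; rewrite ?mul1n ?mul0n.
Qed.

Hypothesis hS : primitive_mx (subdivision_matrix D : 'M[R]_n).

(** Paths compose.  Below v there is a vertex u of the type of v0, reached by at
    least a paths from v0 through v; the b paths from v0 to w, translated to start
    at u, extend each of them. *)
Lemma multiplicity_mul a b v w : (a <= X v.2 v.1)%N -> (b <= X w.2 w.1)%N ->
  exists u, (a * b <= X u.2 u.1)%N.
Proof.
move=> av bw.
have [k hk] := generated_vertex v.1 v.2; have [m hm] := generated_vertex w.1 w.2.
have [N _ hN] := type_reached hS; have [u uv ui] := hN v v0.2.
have uE : u = shift_vertex (u.1 - v0.1) v0.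
  by rewrite /shift_vertex addrC subrK -ui -surjective_pairing.
pose t := shift_vertex (A ^+ m *m (u.1 - v0.1)) w.
exists t; have := family_of_iter_mono (k + N + m) _ _ XX (family_of_vertex _ X0) t.2 t.1.
apply: leq_trans; rewrite -/(desc _ _) /family_of -surjective_pairing.
apply: leq_trans (count_desc_mul (k + N) m v0 u t); apply: leq_mul.
  apply: leq_trans (count_desc_mul k N v0 v u).
  rewrite -[X in (X <= _)%N]muln1; apply: leq_mul.
    by move: av; rewrite -hk /family_of -surjective_pairing.
  by rewrite -has_count has_pred1.
apply: leq_trans bw _; rewrite -hm /family_of -surjective_pairing uE desc_shift.
rewrite count_map; apply: eq_leq; apply: eq_count => z /=.
by rewrite /t (inj_eq (shift_vertex_inj _)).
Qed.

Hypothesis Xbound : exists m, forall v, (X v.2 v.1 <= m)%N.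

(** A multiplicity 2 would give multiplicities 2 ^ m for all m, but weak uniform
    discreteness bounds the multiplicities. *)
Lemma multiplicity_le1 j y : (X j y <= 1)%N.
Proof.
rewrite leqNgt; apply/negP => X2; have [m hm] := Xbound.
have [u] : exists u, (2 ^ m <= X u.2 u.1)%N.
  elim: m {hm} => [|m [u hu]]; first by exists (y, j) => /=; exact: ltnW.
  by rewrite expnS; apply: (@multiplicity_mul 2 (2 ^ m) (y, j) u).
by rewrite leqNgt (leq_ltn_trans (hm u))// ltn_expl.
Qed.

Lemma below_uniq s : family_subset (family_of s) X -> uniq s.
Proof.
move=> sX; have {}sX v : (count_mem v s <= 1)%N.
  by have := sX v.2 v.1; rewrite /family_of -surjective_pairing => /leq_trans; apply;
    exact: multiplicity_le1.
elim: s sX => //= v s IH sX; apply/andP; split.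
  apply/count_memPn; have := sX v; rewrite eqxx add1n ltnS leqn0 => /eqP.
  by [].
by apply: IH => w; apply: leq_trans (sX w); apply: leq_addl.
Qed.

Lemma desc_uniq k v : graph_vertex X v -> uniq (desc k v).
Proof. by move=> Xv; exact/below_uniq/family_of_iter_mono/family_of_vertex. Qed.

(** A common descendant would have multiplicity 2. *)
Lemma desc_disjoint k v w u : graph_vertex X v -> graph_vertex X w -> v != w ->
  u \in desc k v -> u \in desc k w -> False.
Proof.
move=> Xv Xw vw uv uw.
have : uniq (iter k offspring [:: v; w]).
  apply/below_uniq/family_of_iter_mono => // j y; rewrite /family_of /= addn0.
  case: eqP => [vE|_]; last first.
    by have := family_of_vertex _ Xw j y; rewrite /family_of /= addn0.
  rewrite (_ : (w == _) = false); last by rewrite -vE eq_sym (negbTE vw).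
  by move: Xv; rewrite vE.
rewrite iter_offspring /= cats0 cat_uniq => /and3P[_ /hasPn/(_ _ uw)].
by rewrite /= uv.
Qed.

End Irreducible.
End Descent.

(** * The multi-tile equation *)

Section MultiTile.
Context {R : realType} {d n : nat} {A : 'M[R]_d}.
Context {D : 'I_n -> 'I_n -> {fset 'cV[R]_d}}.
Context {th C : R} {N : 'cV[R]_d -> R}.
Notation vertex := ('cV[R]_d * 'I_n)%type.
Notation children := (children A D).
Notation desc := (desc A D).
Hypothesis uA : A \in unitmx.
Hypothesis hN : adapted_norm A th C N.
Hypothesis hS : primitive_mx (subdivision_matrix D : 'M[R]_n).

Definition tile (T : 'I_n -> set 'cV[R]_d) (v : vertex) := translate (T v.2) v.1.

Lemma tileE T v p : tile T v p <-> T v.2 (p - v.1).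
Proof.
by split=> [[t Tt <-]|Tp]; [rewrite addrK | exists (p - v.1); rewrite ?subrK].
Qed.

Lemma tile_shift T x v p : tile T (shift_vertex x v) (p + x) <-> tile T v p.
Proof. by rewrite !tileE /= opprD addrACA subrr addr0. Qed.

(** The multi-tile equation read pointwise along the edges of the graph: the
    transposed indices of the equation are exactly those of the children of (0, i). *)
Definition solves_multitile (T : 'I_n -> set 'cV[R]_d) : Prop :=
  forall i p, T i p <-> exists2 w, w \in children (0, i) & tile T w (A *m p).

Lemma solves_multitileP T :
  (forall i, [set A *m t | t in T i] =
     \bigcup_j \bigcup_(e in [set` D j i]) translate (T j) e) <-> solves_multitile T.
Proof.
split=> [eqT i p|eqT i].
  split=> [Tp|[w /childrenP[e eD we] wp]].
    have : [set A *m t | t in T i] (A *m p) by exists p.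
    rewrite eqT => -[j _ [e /= eD te]]; exists (e, j) => //.
    by apply/childrenP; exists e; rewrite //= mulmx0 add0r.
  have : [set A *m t | t in T i] (A *m p).
    rewrite eqT; exists w.2 => //; exists e => //.
    by move: wp; rewrite /tile we mulmx0 add0r.
  by move=> [t Tt /(congr1 (mulmx (invmx A)))]; rewrite !mulKmx// => <-.
apply/seteqP; split=> [_ [t /eqT[w /childrenP[e eD we] wt] <-]|y].
  by exists w.2 => //; exists e => //; move: wt; rewrite /tile we mulmx0 add0r.
move=> [j _ [e /= eD ey]]; exists (invmx A *m y); last by rewrite mulKVmx.
apply/eqT; exists (e, j); last by rewrite mulKVmx.
by apply/childrenP; exists e; rewrite //= mulmx0 add0r.
Qed.

Section Solution.
Variable T : 'I_n -> set 'cV[R]_d.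
Hypothesis solT : solves_multitile T.

Lemma tile_children v p : tile T v p <-> exists2 w, w \in children v & tile T w (A *m p).
Proof.
case: v => x i; rewrite tileE /= solT.
have -> : (x, i) = shift_vertex x (0, i) by rewrite /shift_vertex /= add0r.
rewrite children_shift; split=> [[w wc Tw]|[_ /mapP[w wc ->] Tw]].
  exists (shift_vertex (A *m x) w); first exact: map_f.
  by rewrite -[A *m p](subrK (A *m x)) tile_shift -mulmxBr.
by exists w => //; rewrite mulmxBr -(tile_shift _ (A *m x)) subrK.
Qed.

(** The tile of v is the union of the tiles of its k-th descendants, shrunk by
    the k-th power of the inverse.  All the geometry rests on this subdivision. *)
Lemma tile_desc k v p : tile T v p <-> exists2 w, w \in desc k v & tile T w (A ^+ k *m p).
Proof.
elim: k v p => [|k IH] v p.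
  rewrite expr0 mul1mx; split=> [Tp|[w]]; first by exists v; rewrite // mem_head.
  by rewrite inE => /eqP ->.
rewrite tile_children; split=> [[c cv /IH[w wc Tw]]|[w]].
  exists w; first by rewrite descS; apply/flatten_mapP; exists c.
  by rewrite exprSr -mulmxE -mulmxA.
rewrite descS => /flatten_mapP[c cv wc] Tw; exists c => //; apply/IH; exists w => //.
by rewrite mulmxA mulmxE -exprSr.
Qed.

Lemma tile_of_desc k v w p : w \in desc k v -> tile T w p -> tile T v (invmx A ^+ k *m p).
Proof. by move=> wv Tw; apply/(tile_desc k); exists w; rewrite // invmx_powK. Qed.

End Solution.

(** Subdividing k times, a point of one solution and a suitable point of the
    other lie in copies of two bounded sets shrunk by th ^ k; closedness concludes. *)
Lemma solution_sub T T' :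
  (forall i, T i !=set0) -> (forall i, Nclosed (N := N) (T i)) ->
  (forall i, exists r, forall x, T i x -> N x <= r) ->
  (forall i, exists r, forall x, T' i x -> N x <= r) ->
  solves_multitile T -> solves_multitile T' -> forall i, T' i `<=` T i.
Proof.
move=> T0 cT /choice[r hr] /choice[r' hr'] sT sT' i p T'p.
apply: contrapT => /cT[e e0 he].
pose B := \sum_j (`|r j| + `|r' j|).
have B0 : 0 <= B by apply: sumr_ge0 => j _; rewrite addr_ge0.
have [k hk] := contract_small hN B e B0 e0.
have : tile T' (0, i) p by rewrite tileE subr0.
move=> /(tile_desc _ sT' k)[w wd /tileE T'w].
have [t Tt] := T0 w.2.
apply: (he (invmx A ^+ k *m (t + w.1))).
  rewrite -[p](mx_powK uA k) -mulmxBr; apply: le_lt_trans (adapted_contract_pow hN _ _) _.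
  apply: le_lt_trans hk; rewrite ler_wpM2l ?exprn_ge0 ?(ltW (adapted_th0 _ _ _ _ hN))//.
  rewrite -addrA -[w.1 - _]opprB; apply: le_trans (adaptedB hN _ _) _.
  apply: le_trans (_ : _ <= `|r w.2| + `|r' w.2|) _; last first.
    by rewrite /B (bigD1 w.2)//= lerDl sumr_ge0// => j _; rewrite addr_ge0.
  apply: lerD; first exact: le_trans (hr _ _ Tt) (ler_norm _).
  exact: le_trans (hr' _ _ T'w) (ler_norm _).
have : tile T (0, i) (invmx A ^+ k *m (t + w.1)).
  by apply: (tile_of_desc _ sT) wd _; rewrite tileE addrK.
by rewrite tileE subr0.
Qed.

Section Existence.

(** The k-th approximation of the tile of v: the union of the shrunken balls of
    radius rho around the k-th descendants. *)
Definition pre_tile (rho : R) k (v : vertex) (p : 'cV[R]_d) :=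
  exists2 w, w \in desc k v & N (A ^+ k *m p - w.1) <= rho.

Lemma pre_tile_shift rho k x v p :
  pre_tile rho k (shift_vertex x v) (p + x) <-> pre_tile rho k v p.
Proof.
rewrite /pre_tile desc_shift; split=> [[_ /mapP[w wd ->]]|[w wd Nw]].
  by rewrite /= mulmxDr opprD addrACA subrr addr0 => Nw; exists w.
exists (shift_vertex (A ^+ k *m x) w); first exact: map_f.
by rewrite /= mulmxDr opprD addrACA subrr addr0.
Qed.

Lemma pre_tileS rho k v p :
  pre_tile rho k.+1 v p <-> exists2 c, c \in children v & pre_tile rho k c (A *m p).
Proof.
rewrite /pre_tile descS; split=> [[w /flatten_mapP[c cv wc] Nw]|[c cv [w wc Nw]]].
  by exists c => //; exists w => //; rewrite mulmxA mulmxE -exprSr.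
exists w; first by apply/flatten_mapP; exists c.
by move: Nw; rewrite mulmxA mulmxE -exprSr.
Qed.

Lemma pigeonhole_nested (T : eqType) (s : seq T) (P : nat -> T -> Prop) :
  (forall k t, P k.+1 t -> P k t) -> (forall k, exists2 t, t \in s & P k t) ->
  exists2 t, t \in s & forall k, P k t.
Proof.
move=> Pdecr Pex; apply: contrapT => nH.
have Pmono k m t : (k <= m)%N -> P m t -> P k t.
  by move=> /subnK <-; elim: (m - k)%N => // l IH; rewrite addSn => /Pdecr.
have : exists k, forall t, t \in s -> ~ P k t.
  elim: s {Pex} nH => [|t s IH] nH; first by exists 0%N.
  have [|k hk] := IH; first by move=> [u us hu]; apply: nH; exists u; rewrite // inE us orbT.
  have [m hm] : exists m, ~ P m t.
    by apply/existsNP => ht; apply: nH; exists t; rewrite // mem_head.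
  exists (maxn k m) => u; rewrite inE => /predU1P[->|us] Pu.
    exact: hm (Pmono _ _ _ (leq_maxr _ _) Pu).
  exact: hk us (Pmono _ _ _ (leq_maxl _ _) Pu).
by move=> [k hk]; have [t ts Pt] := Pex k; exact: hk ts Pt.
Qed.

(** For rho = th delta / (1 - th), where delta bounds the digits, the ball of radius
    rho is mapped into itself by the contractions that define the equation.  The
    approximations therefore decrease, and the solution is their intersection:
    compactness makes it nonempty, and the pigeonhole principle selects one child
    that works at all levels. *)
Lemma multitile_exists : exists T, [/\ forall i, T i !=set0,
  forall i, compact (T i) & solves_multitile T].
Proof.
have th0 := adapted_th0 _ _ _ _ hN; have th1 := adapted_th1 _ _ _ _ hN.
pose delta := \sum_j \sum_i \sum_(e <- D j i) N e.
have N0 := adapted_ge0 hN.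
have hdelta i j e : e \in D j i -> N e <= delta.
  move=> eD; rewrite /delta (bigD1 j)//= (bigD1 i)//= (big_rem e)//=.
  rewrite -!addrA lerDl !addr_ge0// sumr_ge0// => *; rewrite sumr_ge0// => *.
  by rewrite sumr_ge0.
have delta0 : 0 <= delta by do 3! apply: sumr_ge0 => *.
(* the fixed point of rho = th * (rho + delta) *)
pose rho := th * delta / (1 - th).
have rho0 : 0 <= rho.
  by rewrite /rho divr_ge0 ?mulr_ge0 ?(ltW th0)// subr_ge0 ltW.
have rhoE : th * (rho + delta) = rho.
  have : rho * (1 - th) = th * delta by rewrite /rho divfK// subr_eq0 gt_eqF.
  by lra.
have pre_decr k v p : pre_tile rho k.+1 v p -> pre_tile rho k v p.
  move=> [w /mem_descS[u uv /childrenP[e eD we]] Nw]; exists u => //.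
  rewrite -[X in N X](mulKmx uA) mulmxBr mulmxA mulmxE -exprS.
  apply: le_trans (adapted_contract _ _ _ _ hN _) _; rewrite -rhoE.
  apply: ler_wpM2l; first exact: ltW.
  have -> : A ^+ k.+1 *m p - A *m u.1 = (A ^+ k.+1 *m p - w.1) + e.
    by rewrite we opprD addrA subrK.
  apply: le_trans (adaptedD _ _ _ _ hN _ _) _; apply: lerD => //.
  exact: hdelta eD.
have pre_mono k m v p : (k <= m)%N -> pre_tile rho m v p -> pre_tile rho k v p.
  by move=> /subnK <-; elim: (m - k)%N => // l IH; rewrite addSn => /pre_decr.
have pre_closed k v : Nclosed (N := N) (pre_tile rho k v).
  apply: (Nclosed_has _ (desc k v) (fun w => [set p | N (A ^+ k *m p - w.1) <= rho])).
  by move=> w _; exact: Nclosed_ball hN _ _ _.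
pose T i p := forall k, pre_tile rho k (0, i) p.
have T_bounded i p : pre_tile rho 0 (0, i) p -> N p <= rho.
  by move=> [w]; rewrite inE => /eqP ->; rewrite expr0 mul1mx subr0.
have tileT v p : tile T v p <-> forall k, pre_tile rho k v p.
  rewrite tileE /T; split=> H k.
    have := H k; rewrite -(pre_tile_shift _ _ v.1) subrK /shift_vertex /= add0r.
    by rewrite -surjective_pairing.
  rewrite -(pre_tile_shift _ _ v.1) subrK /shift_vertex /= add0r.
  by rewrite -surjective_pairing; exact: H.
exists T; split.
- move=> i; have /choice[w hw] : forall m, exists w, w \in desc m (0, i).
    by move=> m; exact: desc_nonempty.
  apply: (cluster_Nclosed hN (fun k => pre_tile rho k (0, i))
    (fun m => invmx A ^+ m *m (w m).1) rho) => // [k m km|x]; last exact: T_bounded.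
  apply: pre_mono km _; exists (w m) => //.
  by rewrite invmx_powK// subrr (adapted0 hN).
- move=> i; apply: (Nclosed_bounded_compact hN _ rho) => [|x Tx].
    by apply: Nclosed_forall => k; exact: pre_closed.
  exact: T_bounded (Tx 0%N).
move=> i p; split=> [Tp|[c cc /tileT Tc] k].
  have [c cc hc] : exists2 c, c \in children (0, i) & forall k, pre_tile rho k c (A *m p).
    apply: pigeonhole_nested => [k c|k]; first exact: pre_decr.
    exact/pre_tileS.
  by exists c => //; apply/tileT.
by apply: pre_decr; apply/pre_tileS; exists c.
Qed.

End Existence.

End MultiTile.

(** * Covering, interiors and overlaps of the tiles *)

Section Tiling.
Context {R : realType} {d n : nat} {A : 'M[R]_d}.
Context {D : 'I_n -> 'I_n -> {fset 'cV[R]_d}}.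
Context {th C : R} {N : 'cV[R]_d -> R}.
Notation vertex := ('cV[R]_d * 'I_n)%type.
Notation children := (children A D).
Notation desc := (desc A D).
Hypothesis uA : A \in unitmx.
Hypothesis hN : adapted_norm A th C N.
Hypothesis hS : primitive_mx (subdivision_matrix D : 'M[R]_n).
Implicit Types (v w u : vertex) (p q c : 'cV[R]_d) (r : R).

Definition Nball c r : set 'cV[R]_d := [set x | N (x - c) < r].

Definition has_ball (S : set 'cV[R]_d) := exists c, exists2 r, 0 < r & Nball c r `<=` S.

Lemma Nball_sub c r p e : e <= r - N (p - c) -> Nball p e `<=` Nball c r.
Proof.
by move=> er x; rewrite /Nball /= => xp; have := adapted_triangle hN p x c; lra.
Qed.

(** The finite case of the Baire property: a point of the ball outside the first
    closed set has a whole ball outside it, which the other sets must cover. *)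
Lemma has_ball_seq (T : eqType) (s : seq T) (F : T -> set 'cV[R]_d) c r :
  (forall t, t \in s -> Nclosed (N := N) (F t)) -> 0 < r ->
  (forall x, Nball c r x -> exists2 t, t \in s & F t x) ->
  exists2 t, t \in s & has_ball (Nball c r `&` F t).
Proof.
elim: s c r => [|t s IH] c r cF r0 cov.
  by have [] := cov c ltac:(by rewrite /Nball /= subrr (adapted0 hN)).
have [|/existsNP[p /not_implyP[cp np]]] := pselect (Nball c r `<=` F t).
  move=> sub; exists t; first exact: mem_head.
  by exists c, r => // x xc; split => //; exact: sub.
have [e e0 he] := cF t (mem_head _ _) p np.
pose r' := Num.min e (r - N (p - c)).
have sub : Nball p r' `<=` Nball c r by apply: Nball_sub; rewrite ge_min lexx orbT.
have [|||u us [c' [r2 r20 h2]]] := IH p r'.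
- by move=> u us; apply: cF; rewrite inE us orbT.
- by rewrite lt_min e0 subr_gt0.
- move=> x px; have [u] := cov x (sub _ px); rewrite inE => /predU1P[->|us Fu].
    by move=> /he; case; move: px; rewrite /Nball /= lt_min => /andP[].
  by exists u.
exists u; first by rewrite inE us orbT.
by exists c', r2 => // x /h2[/sub]; split.
Qed.

Variable T : 'I_n -> set 'cV[R]_d.
Hypothesis T0 : forall i, T i !=set0.
Hypothesis cT : forall i, Nclosed (N := N) (T i).
Variable rho : R.
Hypothesis rho0 : 0 <= rho.
Hypothesis Trho : forall i x, T i x -> N x <= rho.
Hypothesis solT : solves_multitile (A := A) (D := D) T.
Notation tile := (tile T).

Lemma tile_closed v : Nclosed (N := N) (tile v).
Proof. exact: Nclosed_translate. Qed.

Lemma tile_near v p : tile v p -> N (v.1 - p) <= rho.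
Proof. by move=> /tileE/Trho; rewrite (adapted_sym hN). Qed.

Arguments tile_near {v p}.

Lemma tile_diam v p q : tile v p -> tile v q -> N (p - q) <= 2 * rho.
Proof.
move=> /tile_near vp /tile_near vq; have := adapted_triangle hN v.1 p q.
by rewrite [N (p - v.1)](adapted_sym hN); lra.
Qed.

Arguments tile_diam {v p q}.

Lemma tile_diam_pow k v p q : tile v (A ^+ k *m p) -> tile v (A ^+ k *m q) ->
  N (p - q) <= th ^+ k * (2 * rho).
Proof.
move=> vp vq; rewrite -[p](mx_powK uA k) -[q](mx_powK uA k) -mulmxBr.
apply: le_trans (adapted_contract_pow hN _ _) _.
rewrite ler_wpM2l ?exprn_ge0 ?(ltW (adapted_th0 _ _ _ _ hN))//.
exact: tile_diam vp vq.
Qed.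

Arguments tile_diam_pow {k v p q}.

Lemma has_ball_tile v : has_ball (tile v) <-> has_ball (T v.2).
Proof.
split=> -[c [r r0 sub]].
  exists (c - v.1), r => // x xc.
  have /tileE : tile v (x + v.1) by apply: sub; move: xc; rewrite /Nball /= opprB addrA.
  by rewrite addrK.
exists (c + v.1), r => // x xc; apply/tileE; apply: sub.
by move: xc; rewrite /Nball /= opprD addrA addrAC.
Qed.

Lemma has_ball_desc k v w : w \in desc k v -> has_ball (tile w) ->
  has_ball [set x | tile v x /\ tile w (A ^+ k *m x)].
Proof.
move=> wv [c [r r0 sub]]; have [L L0 hL] := adapted_lipschitz hN k.
exists (invmx A ^+ k *m c), (r / L); first by rewrite divr_gt0.
move=> x; rewrite /Nball /= ltr_pdivlMr// => xc.
have wx : tile w (A ^+ k *m x).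
  apply: sub; rewrite /Nball /= -[c](invmx_powK uA k) -mulmxBr.
  by apply: le_lt_trans (hL _) _; rewrite mulrC.
by split=> //; apply/(tile_desc _ solT k); exists w.
Qed.

Arguments has_ball_desc {k v w}.

Variable X : multiset_family R d n.
Hypothesis irr : irreducible_family A D X.
Variable v0 : vertex.
Hypothesis X0 : graph_vertex X v0.
Hypothesis loop_v0 : graph_edge A D v0 v0.
Hypothesis wD : forall i, weak_delone (X i).

Lemma vertex_bound (r : R) : exists B, forall c (s : seq vertex), uniq s ->
  (forall v, v \in s -> graph_vertex X v /\ N (v.1 - c) <= r) -> (size s <= B)%N.
Proof.
have /choice[B hB] : forall i, exists B, forall c (s : seq 'cV[R]_d), uniq s ->
    (forall x, x \in s -> (0 < X i x)%N /\ l1norm (x - c) <= r) -> (size s <= B)%N.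
  by move=> i; apply: weakly_uniformly_discrete_bounded; case: (wD i).
exists (\sum_i B i)%N => c s us hs.
have -> : size s = (\sum_i size [seq v <- s | v.2 == i])%N.
  elim: s {us hs} => [|v s IH] /=; first by rewrite big1.
  rewrite IH (bigD1 v.2)//= [RHS](bigD1 v.2)//= eqxx /= addSn; congr (_ + _).+1.
  by apply: eq_bigr => i; rewrite eq_sym => /negbTE ->.
apply: leq_sum => i _.
rewrite -(size_map fst); apply: (hB i c).
  rewrite map_inj_in_uniq ?filter_uniq// => -[x j] [y l].
  by rewrite !mem_filter /= => /andP[/eqP -> _] /andP[/eqP -> _] ->.
move=> _ /mapP[[x j] + ->]; rewrite mem_filter /= => /andP[/eqP -> /hs[Xx xr]].
by split=> //; exact: le_trans (adapted_ge _ _ _ _ hN _) xr.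
Qed.

Lemma vertices_near c (r : R) : exists s : seq vertex,
  forall v, v \in s <-> graph_vertex X v /\ N (v.1 - c) <= r.
Proof.
have [B hB] := vertex_bound r.
exact: bounded_enumeration (hB c).
Qed.

Lemma multiplicity_bounded : exists m, forall v, (X v.2 v.1 <= m)%N.
Proof.
have /choice[m hm] : forall i, exists m, forall x, (X i x <= m)%N.
  move=> i; have [[r [m [r0 _ hr]]] _] := wD i; exists m => x.
  have := discrete_with_seq _ _ _ x [:: x] hr isT; rewrite big_seq1; apply.
  move=> y; rewrite inE => /eqP ->.
  apply: le_lt_trans r0; apply: le_trans (enorm_le_l1norm _) _.
  by rewrite subrr /l1norm big1// => j _; rewrite mxE normr0.
exists (\max_i m i)%N => v; apply: leq_trans (hm v.2 v.1) _; exact: leq_bigmax.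
Qed.

(** Every vertex has a parent, so the covered set is stable under the inverse. *)
Lemma covered_invmx k p : (exists2 v, graph_vertex X v & tile v p) ->
  exists2 v, graph_vertex X v & tile v (invmx A ^+ k *m p).
Proof.
elim: k p => [|k IH] p [v Xv vp]; first by exists v; rewrite // expr0 mul1mx.
have [u Xu vu] := graph_vertex_parent A D uA X irr _ Xv.
rewrite exprSr -mulmxE -mulmxA; apply: IH; exists u => //.
by apply/(tile_children _ solT); exists v; rewrite // mulKVmx.
Qed.

(** Relative density puts a covered point at bounded distance from the k-th image
    of p; pulled back by the inverse it is still covered, and as close to p as
    wanted.  Local finiteness makes the covered set closed at p. *)
Lemma tiles_cover p : exists2 v, graph_vertex X v & tile v p.
Proof.
have [i _] : exists i : 'I_n, True by exists v0.2.
have [_ [r r0 hr]] := wD i; have [t Tt] := T0 i.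
have [s hs] := vertices_near p (rho + 1).
apply: contrapT => nc.
have [|e e0 he] := Nclosed_has _ s tile (fun v _ => tile_closed v) p.
  by move=> [v /hs[Xv _] vp]; apply: nc; exists v.
(* a bound on the distance from the k-th image of p to the covered point t + x *)
pose B := rho + C * (d%:R * r).
have B0 : 0 <= B.
  by rewrite addr_ge0// !mulr_ge0// ltW// (adapted_C0 _ _ _ _ hN).
have [k hk] := contract_small hN B (Num.min e 1) B0 ltac:(by rewrite lt_min e0 ltr01).
have [x Xx xr] := hr (A ^+ k *m p).
have [v Xv vq] : exists2 v, graph_vertex X v & tile v (invmx A ^+ k *m (t + x)).
  by apply: covered_invmx; exists (x, i) => //; exists t.
set q := invmx A ^+ k *m (t + x) in vq *.
have : N (q - p) < Num.min e 1.
  apply: le_lt_trans hk; rewrite -[p](mx_powK uA k) -mulmxBr.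
  apply: le_trans (adapted_contract_pow hN _ _) _.
  rewrite ler_wpM2l ?exprn_ge0 ?(ltW (adapted_th0 _ _ _ _ hN))// -addrA.
  apply: le_trans (adaptedD _ _ _ _ hN _ _) _; apply: lerD; first exact: Trho Tt.
  apply: le_trans (adapted_le _ _ _ _ hN _) _.
  rewrite ler_wpM2l ?(ltW (adapted_C0 _ _ _ _ hN))//.
  by apply: le_trans (l1norm_le_enorm _) _; rewrite ler_wpM2l.
rewrite lt_min => /andP[qe q1]; apply: (he q) => //; exists v => //.
apply/hs; split=> //; have := adapted_triangle hN q v.1 p; have := tile_near vq; lra.
Qed.

Lemma has_ballS (S S' : set 'cV[R]_d) : S `<=` S' -> has_ball S -> has_ball S'.
Proof. by move=> SS' [c [r r0 h]]; exists c, r => // x /h /SS'. Qed.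

Arguments has_ballS {S} S'.

(** Finitely many tiles cover a ball, so one of them has interior, and by
    primitivity every tile contains a shrunken translate of that one. *)
Lemma tile_has_ball v : has_ball (tile v).
Proof.
have [s hs] := vertices_near 0 (rho + 1).
have [|||w ws fw'] := @has_ball_seq _ s tile 0 1.
- by move=> w _; exact: tile_closed.
- by [].
- move=> x; rewrite /Nball /= subr0 => x1; have [w Xw wx] := tiles_cover x.
  exists w => //; apply/hs; split=> //; rewrite subr0.
  have := tile_near wx; have := adaptedD _ _ _ _ hN (w.1 - x) x; rewrite subrK; lra.
have fw : has_ball (T w.2) by apply/(has_ball_tile _).1/(has_ballS _ _ fw') => x [].
have [k _ /(_ v w.2)[u uv uw]] := type_reached A D hS.
have /(has_ball_desc uv) : has_ball (tile u) by apply/has_ball_tile; rewrite uw.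
by apply: has_ballS => x [].
Qed.

(** A tile is the closure of its interior, as it is made of arbitrarily small
    tiles which all contain balls. *)
Lemma tile_has_ball_near v p (e : R) : tile v p -> 0 < e -> has_ball (tile v `&` Nball p e).
Proof.
move=> vp e0.
have [k hk] := contract_small hN (2 * rho) e (mulr_ge0 (ler0n _ 2) rho0) e0.
have [w wv wp] := (tile_desc _ solT k _ _).1 vp.
apply: has_ballS (has_ball_desc wv (tile_has_ball w)) => x [vx wx]; split=> //.
exact: le_lt_trans (tile_diam_pow wx wp) hk.
Qed.

Definition overlapping (s : seq vertex) := [/\ uniq s,
  forall v, v \in s -> graph_vertex X v & has_ball [set x | forall v, v \in s -> tile v x]].

(** Let v and w be two of the vertices in s.  Deep enough below v lies a vertex u
    whose tile, once shrunk, is inside the common ball, and below u lies a translate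
    of the whole configuration s, since s descends from v0.  The common ball of this
    translate is also covered by the tiles of the descendants of w, one of which must
    contain a smaller ball; it is a new vertex, because v and w have no common
    descendant. *)
Lemma overlap_grow s : (1 < size s)%N -> overlapping s ->
  exists2 s', size s' = (size s).+1 & overlapping s'.
Proof.
move=> s1 [us sX [c [r r0 sub]]].
have [v [w [vs ws vw]]] : exists v w, [/\ v \in s, w \in s & v != w].
  case: s s1 us {sX sub} => [|v [|w s]]//= _; rewrite inE negb_or => /andP[/andP[vw _] _].
  by exists v, w; rewrite !inE !eqxx orbT.
have cs u : u \in s -> tile u c.
  by move=> us'; apply: sub => //; rewrite /Nball /= subrr (adapted0 hN).
have [K hK] := generated_seq A D uA X irr v0 X0 loop_v0 s sX.
have [k hk] := contract_small hN (2 * rho) r (mulr_ge0 (ler0n _ 2) rho0) r0.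
have [u uv uc] := (tile_desc _ solT k _ _).1 (cs v vs).
have [m _ /(_ u v0.2)[u' u'u u'0]] := type_reached A D hS.
(* u' is v0 translated, so its K-th descendants include s translated by a *)
pose a := A ^+ K *m (u'.1 - v0.1).
have sd z : z \in s -> shift_vertex a z \in desc (m + K) u.
  move=> /hK zd; apply/mem_descD; exists u' => //.
  have -> : u' = shift_vertex (u'.1 - v0.1) v0.
    by rewrite /shift_vertex addrC subrK -u'0 -surjective_pairing.
  by rewrite desc_shift; apply: map_f.
have sdv z : z \in s -> shift_vertex a z \in desc (k + (m + K)) v.
  by move=> /sd zd; apply/mem_descD; exists u.
have [|||w' w'w [c' [r' r'0 h']]] :=
    @has_ball_seq _ (desc (k + (m + K)) w) tile (c + a) r.
- by move=> *; exact: tile_closed.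
- by [].
- move=> x xc; rewrite -[x](invmx_powK uA (k + (m + K))).
  apply: ((tile_desc _ solT _ _ _).1 (sub _ _ w ws)).
  set y := invmx A ^+ (m + K) *m x.
  have yu : tile u y.
    apply: (tile_of_desc uA _ solT) (sd v vs) _.
    rewrite -[x](subrK a) tile_shift; apply: sub => //.
    by move: xc; rewrite /Nball /= opprD addrA addrAC.
  rewrite exprD -mulmxE -mulmxA -/y /Nball /=.
  by apply: le_lt_trans hk; apply: (@tile_diam_pow _ u) => //; rewrite invmx_powK.
exists (w' :: map (shift_vertex a) s); first by rewrite /= size_map.
split.
- rewrite /= map_inj_uniq ?us ?andbT; last exact: shift_vertex_inj.
  apply/negP => /mapP[z zs w'E].
  apply: (desc_disjoint A D uA X irr v0 X0 loop_v0 hS multiplicity_bounded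
    (k + (m + K)) v w w'); rewrite ?sX// w'E; exact: sdv.
- move=> z; rewrite inE => /predU1P[->|/mapP[y ys ->]].
    exact: graph_vertex_desc (sX w ws) w'w.
  exact: graph_vertex_desc (sX v vs) (sdv y ys).
exists c', r' => // x /h'[xc w'x] z; rewrite inE => /predU1P[->//|/mapP[y ys ->]].
rewrite -[x](subrK a) tile_shift; apply: sub => //.
by move: xc; rewrite /Nball /= opprD addrA addrAC.
Qed.

(** Otherwise arbitrarily many tiles of X would share a point, against local
    finiteness. *)
Lemma tiles_overlap_free v w : graph_vertex X v -> graph_vertex X w -> v != w ->
  ~ has_ball (tile v `&` tile w).
Proof.
move=> Xv Xw vw fvw.
(* starting from the pair v, w, the overlap grows indefinitely *)
have ov k : exists2 s, size s = k.+2 & overlapping s.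
  elim: k => [|k [s sk /overlap_grow[|s' s'k os']]].
  - exists [:: v; w] => //; split; first by rewrite /= inE vw.
      by move=> u; rewrite !inE => /orP[]/eqP ->.
    by apply: has_ballS fvw => x [vx wx] u; rewrite !inE => /orP[]/eqP ->.
  - by rewrite sk.
  by exists s'; rewrite // s'k sk.
have [B hB] := vertex_bound rho.
have [s sB [us sX [c [r r0 sub]]]] := ov B.
have := hB c s us; rewrite sB => H; suff : (B.+2 <= B)%N by rewrite ltnNge leqnSn.
apply: H => u us'; split; first exact: sX.
by apply: tile_near; apply: sub => //; rewrite /Nball /= subrr (adapted0 hN).
Qed.

(** * Tiles meet in null sets *)

(** Some descendant h of each type has its shrunken tile in a ball inside the tile
    of z.  No tile of another vertex meets this ball, for it would share a smaller
    ball with it.  The depth K does not depend on z, as there are finitely many types. *)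
Lemma interior_descendant : exists K, forall z j, graph_vertex X z ->
  exists2 h, h \in desc K z & h.2 = j /\
    forall z' p, graph_vertex X z' -> z' != z -> tile z' p -> ~ tile h (A ^+ K *m p).
Proof.
have /choice[c /choice[r hr]] : forall i, exists c, exists r,
    0 < r /\ Nball c r `<=` T i.
  by move=> i; have /has_ball_tile[c [r r0 sub]] := tile_has_ball (0, i); exists c, r.
pose e := \big[Num.min/1]_i r i.
have e0 : 0 < e by apply: lt_bigmin => [|i _]; [exact: ltr01 | case: (hr i)].
have [k hk] := contract_small hN (2 * rho) e (mulr_ge0 (ler0n _ 2) rho0) e0.
have [m _ hm] := type_reached A D hS.
exists (k + m)%N => z j Xz.
pose b := c z.2 + z.1.
have sub : Nball b e `<=` tile z.
  move=> x xb; apply/tileE; apply: (hr z.2).2.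
  apply: (@lt_le_trans _ _ e); last exact: bigmin_le.
  by move: xb; rewrite /Nball /= /b opprD addrA addrAC.
have [|u uz ub] := (tile_desc _ solT k z b).1.
  by apply: sub; rewrite /Nball /= subrr (adapted0 hN).
have [h hu hj] := hm u j.
exists h; first by apply/mem_descD; exists u.
split=> // z' p Xz' z'z z'p hp.
have up : tile u (A ^+ k *m p).
  apply/(tile_desc _ solT m); exists h => //.
  by rewrite mulmxA mulmxE -exprD addnC.
have pb : N (p - b) < e by exact: le_lt_trans (tile_diam_pow up ub) hk.
apply: (tiles_overlap_free z' z Xz' Xz z'z).
apply: has_ballS (tile_has_ball_near z' p (e - N (p - b)) z'p _); last by rewrite subr_gt0.
by move=> x [z'x /(Nball_sub b e _ _ (lexx _)) /sub].
Qed.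

Lemma sum_by_type (V : nmodType) (f : 'I_n -> V) (s : seq vertex) :
  \sum_(z <- s) f z.2 = \sum_l f l *+ type_count l s.
Proof.
elim: s => [|z s IH]; first by rewrite big_nil big1// => l _; rewrite mulr0n.
rewrite big_cons IH /type_count /= [in RHS](bigD1 z.2)//= [in LHS](bigD1 z.2)//=.
rewrite eqxx mulrnDr mulr1n addrA; congr (_ + _).
by apply: eq_bigr => l /negbTE; rewrite eq_sym => ->.
Qed.

Lemma sum_by_type_nat (f : 'I_n -> nat) (s : seq vertex) :
  (\sum_(z <- s) f z.2 = \sum_l type_count l s * f l)%N.
Proof.
rewrite sum_by_type; apply: eq_bigr => l _.
by elim: (type_count l s) => [|q IH]; rewrite ?mul0n// mulrS mulSn -IH.
Qed.

Definition descent_count k j i : nat := type_count j (desc k (0, i)).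

Lemma type_count_desc_vertex k j v : type_count j (desc k v) = descent_count k j v.2.
Proof. by case: v => x i; rewrite desc_origin type_count_shift. Qed.

Lemma type_count_descD k m j v : type_count j (desc (k + m) v) =
  (\sum_(z <- desc k v) descent_count m j z.2)%N.
Proof.
rewrite descD /type_count count_flatten sumnE !big_map; apply: eq_bigr => z _.
by rewrite -type_count_desc_vertex.
Qed.

Lemma count_predI_lt (S : eqType) (a b : pred S) (s : seq S) h :
  h \in s -> a h -> ~~ b h -> (count (predI a b) s < count a s)%N.
Proof.
move=> hs ah bh; rewrite -(size_filter a) -(count_predC b [seq x <- s | a x]).
rewrite count_filter (eq_count (a2 := predI b a)) => [|x /=]; last by rewrite andbC.
by rewrite -[X in (X < _)%N]addn0 ltn_add2l -has_count; apply/hasP;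
  exists h => //=; rewrite mem_filter ah.
Qed.

(** Some value is at most the mean. *)
Lemma seq_mean (S : eqType) (s : seq S) (f : S -> nat) B : s != [::] ->
  (\sum_(x <- s) f x <= B)%N -> exists2 x, x \in s & (size s * f x <= B)%N.
Proof.
move=> s0 sB; have [x xs xmin] : exists2 x, x \in s & forall y, y \in s -> (f x <= f y)%N.
  elim: s s0 {sB} => [//|x [|x' s] IH] _.
    by exists x; rewrite ?mem_head// => y; rewrite inE => /eqP ->.
  have [//|y ys ymin] := IH.
  have [xy|yx] := leqP (f x) (f y).
    exists x; first exact: mem_head.
    by move=> z; rewrite inE => /predU1P[->//|/ymin]; exact: leq_trans.
  exists y; first by rewrite inE ys orbT.
  by move=> z; rewrite inE => /predU1P[->|/ymin//]; exact: ltnW.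
exists x => //; apply: leq_trans sB.
rewrite -sum1_size big_distrl /= big_seq [X in (_ <= X)%N]big_seq.
by apply: leq_sum => y ys; rewrite mul1n xmin.
Qed.

(** A double count.  The shrunken tiles of the
    descendants of v of one type are translates of each other inside the tile of v,
    which a grid covers.  The cells are taken so small that the k-th power of A maps
    them to sets of diameter at most 1; each cell then meets at most B of the
    shrunken tiles.  Hence some shrunken tile meets at most B / (their number) of all
    the cells, and the others have the same content. *)
Lemma piece_volume v : graph_vertex X v -> exists2 V : R, 0 <= V &
  forall k z, z \in desc k v ->
    finitely_boxed [set p | tile z (A ^+ k *m p)] (V / (type_count z.2 (desc k v))%:R).
Proof.
move=> Xv; have [B hB] := vertex_bound (rho + 1).
pose a := Num.bound (N v.1 + rho).
have Na : N v.1 + rho < a%:R.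
  by apply: archi_boundP; rewrite addr_ge0// (adapted_ge0 hN).
have va p : tile v p -> forall i, - a%:R < p i 0 <= a%:R.
  move=> vp i; have : `|p i 0| < a%:R.
    apply: le_lt_trans Na; apply: le_trans (ler_coord_l1norm _ _ _) _.
    apply: le_trans (adapted_ge _ _ _ _ hN _) _.
    have := adaptedB hN v.1 (v.1 - p); rewrite subKr; have := tile_near vp; lra.
  by rewrite ltr_norml => /andP[-> /ltW ->].
exists ((2 * a%:R) ^+ d * B%:R).
  by rewrite mulr_ge0// exprn_ge0// mulr_ge0.
move=> k z zv.
have [L L0 hL] := adapted_lipschitz hN k.
have C0 := adapted_C0 _ _ _ _ hN.
have LC : 0 <= L * C * d%:R by rewrite !mulr_ge0// ltW.
pose M := Num.bound (L * C * d%:R).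
have hM : L * C * d%:R < M%:R by exact: archi_boundP.
have MR : 0 < M%:R :> R by exact: le_lt_trans hM.
have M0 : (0 < M)%N by rewrite -(ltr0n R).
(* N is at most C times the l1 norm, A ^+ k is L-Lipschitz, and C * L * d < M *)
have cell_small (g : @grid_index d a M) (p q : 'cV[R]_d) :
    box (grid_cell a M g) p -> box (grid_cell a M g) q -> N (A ^+ k *m p - A ^+ k *m q) <= 1.
  move=> pg qg; rewrite -mulmxBr; apply: le_trans (hL _) _.
  apply: le_trans (_ : L * (C * (d%:R / M%:R)) <= _).
    rewrite ler_wpM2l ?(ltW L0)//; apply: le_trans (adapted_le _ _ _ _ hN _) _.
    rewrite ler_wpM2l ?(ltW C0)//.
    apply: le_trans (_ : \sum_(i < d) M%:R^-1 <= _).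
      apply: ler_sum => i _; rewrite !mxE; exact: (grid_cell_dist _ _ g).
    by rewrite sumr_const card_ord mulr_natl.
  by rewrite !mulrA ler_pdivrMr// mul1r ltW.
pose meets (g : @grid_index d a M) (u : vertex) :=
  `[< exists2 p, box (grid_cell a M g) p & tile u (A ^+ k *m p) >].
pose zs := [seq u <- desc k v | u.2 == z.2].
have zzs : z \in zs by rewrite mem_filter eqxx.
have szs : size zs = type_count z.2 (desc k v) by rewrite size_filter.
have uzs : uniq zs.
  apply: filter_uniq.
  exact: (desc_uniq A D uA X irr v0 X0 loop_v0 hS multiplicity_bounded).
have Xzs u : u \in zs -> graph_vertex X u.
  by rewrite mem_filter => /andP[_]; exact: graph_vertex_desc.
have tot : (\sum_(u <- zs) #|[pred g | meets g u]| <= #|@grid_index d a M| * B)%N.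
  under eq_bigr do rewrite -sum1_card big_mkcond /=.
  rewrite exchange_big /= -sum_nat_const; apply: leq_sum => g _.
  have -> : (\sum_(u <- zs) (if meets g u then 1 else 0) =
      size [seq u <- zs | meets g u])%N.
    by rewrite size_filter -sum1_count [RHS]big_mkcond.
  case sE : [seq u <- zs | meets g u] => [//|u0 s]; rewrite -sE.
  have : u0 \in [seq u <- zs | meets g u] by rewrite sE mem_head.
  rewrite mem_filter => /andP[/asboolP[p0 p0g _] _].
  apply: (hB (A ^+ k *m p0)); first exact: filter_uniq.
  move=> u; rewrite mem_filter => /andP[/asboolP[p pg up] /Xzs Xu]; split=> //.
  have := adapted_triangle hN (A ^+ k *m p) u.1 (A ^+ k *m p0).
  have := cell_small g p p0 pg p0g; have := tile_near up; lra.
have [|u uzs' hu] := seq_mean _ zs _ _ _ tot; first by case: (zs) zzs.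
have /andP[/eqP uz uv] : (u.2 == z.2) && (u \in desc k v).
  by move: uzs'; rewrite mem_filter.
have s0 : (0 < size zs)%N by case: (zs) zzs.
have boxu : finitely_boxed [set p | tile u (A ^+ k *m p)]
    ((2 * a%:R) ^+ d * B%:R / (type_count z.2 (desc k v))%:R).
  apply: finitely_boxedS (finitely_boxed_bigcup _ (enum [pred g | meets g u])
    (fun g => box (grid_cell a M g)) (fun=> M%:R^-1 ^+ d)
    [set p | tile u (A ^+ k *m p)] _ _) => //.
  - rewrite big_enum sumr_const -szs -[_ *+ _]mulr_natr ler_pdivlMr ?ltr0n//.
    have : (size zs * #|[pred g | meets g u]|)%:R <= (#|@grid_index d a M| * B)%:R :> R.
      by rewrite ler_nat.
    rewrite card_grid_index !natrM natrX => hu'.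
    rewrite -mulrA mulrC [X in X * _ <= _]mulrC.
    apply: le_trans (ler_wpM2r _ hu') _; first by rewrite exprn_ge0// invr_ge0.
    rewrite !natrM [in leLHS]exprMn [leLHS]mulrAC -[_ ^+ d * _ * (_ ^+ d)]mulrA -exprMn.
    by rewrite mulfV ?gt_eqF// expr1n mulr1.
  - move=> p up; have vp : tile v p by apply/(tile_desc _ solT k); exists u.
    have [g gp] := grid_cell_cover a M M0 p (va p vp).
    exists g => //; rewrite mem_enum; apply/asboolP; by exists p.
  - move=> g _; exists [:: grid_cell a M g].
      by move=> x xg; exists (grid_cell a M g); rewrite ?mem_head.
    by rewrite big_seq1 grid_cell_volume.
pose b := invmx A ^+ k *m (z.1 - u.1).
apply: finitely_boxedS (lexx _) (finitely_boxed_translate _ _ b boxu).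
move=> p zp; exists (p - b); last by rewrite subrK.
rewrite /= mulmxBr /b (invmx_powK uA).
rewrite -(tile_shift _ (z.1 - u.1)) subrK.
suff -> : shift_vertex (z.1 - u.1) u = z by [].
by rewrite /shift_vertex addrC subrK uz -surjective_pairing.
Qed.

Section Contact.
Variables v w : vertex.
Hypothesis Xv : graph_vertex X v.
Hypothesis Xw : graph_vertex X w.
Hypothesis vw : v != w.

Definition contact k : pred vertex :=
  fun z => `[< exists p, [/\ tile v p, tile w p & tile z (A ^+ k *m p)] >].

Definition contact_desc k : seq vertex := [seq z <- desc k v | contact k z].

(** Under K further subdivisions, each descendant has at least one descendant of
    each type that stays away from the other tile, out of at most M + 1.  So the
    proportion, type by type, of the descendants of v that touch w is multiplied by
    at most M / (M + 1) every K steps. *)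
Lemma contact_desc_count : exists K M, forall t l,
  (M.+1 ^ t * type_count l (contact_desc (t * K)) <=
   M ^ t * type_count l (desc (t * K) v))%N.
Proof.
have [K hK] := interior_descendant.
pose m := descent_count K.
pose M := (\sum_j \sum_l m j l)%N.
have mM j l : (m j l <= M.+1)%N.
  by rewrite /M (bigD1 j)//= (bigD1 l)//= -addnA leqW// leq_addr.
exists K, M; elim=> [|t IH] j.
  by rewrite !expn0 !mul1n; apply: leq_count_subseq; exact: filter_subseq.
set k := (t * K)%N in IH *; rewrite mulSn addnC -/k.
have step : (type_count j (contact_desc (k + K)) <=
    \sum_(z <- contact_desc k) (m j z.2).-1)%N.
  rewrite /type_count count_filter descD count_flatten sumnE !big_map.
  rewrite [X in (_ <= X)%N]big_filter [X in (_ <= X)%N]big_mkcond /=.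
  rewrite big_seq [X in (_ <= X)%N]big_seq; apply: leq_sum => z zv.
  case: ifPn => [_|nz].
    have Xz := graph_vertex_desc A D uA X irr k v z Xv zv.
    have [h hz [hj hh]] := hK z j Xz.
    rewrite /m -type_count_desc_vertex -ltnS prednK.
      apply: (count_predI_lt _ _ _ _ h); rewrite ?hj//.
      apply/asboolP => -[p [_ wp]]; rewrite addnC exprD -mulmxE -mulmxA.
      have [z' z'w z'p] := (tile_desc _ solT k _ _).1 wp.
      apply: (hh z') => //; first exact: graph_vertex_desc z'w.
      apply/eqP => z'z; rewrite z'z in z'w.
      exact: (desc_disjoint A D uA X irr v0 X0 loop_v0 hS multiplicity_bounded k v w z).
    by rewrite -has_count; apply/hasP; exists h => //; rewrite hj.
  rewrite leqn0 -leqn0 leqNgt -has_count; apply: contra nz => /hasP[h hz /andP[_]].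
  move=> /asboolP[p [vp wp hp]]; apply/asboolP; exists p; split=> //.
  apply/(tile_desc _ solT K); exists h => //.
  by rewrite mulmxA mulmxE -exprD addnC.
rewrite type_count_descD.
apply: (@leq_trans (M.+1 ^ t * \sum_(z <- contact_desc k) (M * m j z.2))%N).
  rewrite expnSr -mulnA leq_mul2l; apply/orP; right.
  apply: leq_trans (leq_mul (leqnn _) step) _; rewrite big_distrr /=.
  apply: leq_sum => z _; have := mM j z.2; case: (m j z.2) => // q qM.
  by rewrite /= mulSn mulnS leq_add2r.
rewrite (sum_by_type_nat (fun l => M * m j l)%N) (sum_by_type_nat (m j)).
rewrite !big_distrr /=; apply: leq_sum => l _; rewrite !mulnA leq_mul2r expnSr.
by apply/orP; right; rewrite [X in (_ <= X)%N]mulnAC leq_mul2r IH orbT.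
Qed.

(** The contact set is covered by the shrunken tiles of the touching descendants.
    Their content is inversely proportional to the number of all the descendants of
    the same type, of which they form a vanishing proportion. *)
Lemma contact_null : (0 < d)%N -> lebesgue (tile v `&` tile w) = 0%E.
Proof.
move=> d0; apply/eqP; rewrite eq_le; apply/andP; split; last first.
  apply/ereal_infP => _ [F _ <-]; apply: nneseries_ge0 => k _ _.
  by rewrite lee_fin box_volume_ge0.
have [V V0 hV] := piece_volume v Xv.
have [K [M hKM]] := contact_desc_count.
apply/lee_addgt0Pr => e e0; rewrite add0e.
pose th' : R := M%:R / M.+1%:R.
have th'0 : 0 <= th' by rewrite divr_ge0.
have th'1 : th' < 1 by rewrite ltr_pdivrMr// mul1r ltr_nat.
have [t ht] := expr_lt_eps th' (e / (n%:R * V + 1)) th'0 th'1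
  ltac:(by rewrite divr_gt0// ltr_wpDl// mulr_ge0).
apply: finitely_boxed_lebesgue => //.
apply: finitely_boxedS (finitely_boxed_bigcup _ (contact_desc (t * K))
  (fun z => [set p | tile z (A ^+ (t * K) *m p)])
  (fun z => V / (type_count z.2 (desc (t * K) v))%:R) (tile v `&` tile w) _ _) => //.
- rewrite (sum_by_type _ (fun l => V / (type_count l (desc (t * K) v))%:R)).
  apply: (@le_trans _ _ (\sum_(l < n) (V * th' ^+ t))).
    apply: ler_sum => l _; set q := type_count l (desc _ _).
    rewrite -[_ *+ type_count _ _]mulr_natr -mulrA ler_wpM2l//.
    have [->|q0] := posnP q; first by rewrite invr0 mul0r exprn_ge0.
    rewrite mulrC ler_pdivrMr ?ltr0n// /th' expr_div_n mulrAC.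
    rewrite ler_pdivlMr ?exprn_gt0// -!natrX -!natrM ler_nat mulnC.
    exact: hKM.
  rewrite sumr_const card_ord -mulr_natl mulrA.
  move: ht; rewrite ltr_pdivlMr; last by rewrite ltr_wpDl// mulr_ge0.
  move=> ht; apply: le_trans (ltW ht); rewrite mulrC ler_wpM2l ?exprn_ge0//.
  by rewrite lerDl.
- move=> p [vp wp]; have [z zv zp] := (tile_desc _ solT (t * K) _ _).1 vp.
  by exists z => //; rewrite mem_filter zv andbT; apply/asboolP; exists p.
- by move=> z; rewrite mem_filter => /andP[_]; exact: hV.
Qed.

End Contact.

(** * Consequences: Delone sets and tiles of positive measure *)

(** Weak uniform discreteness and simple multiplicities do not suffice: points
    could cluster in pairs.  The ball in the tile forbids it, since two close points
    of one type would have tiles that share a ball. *)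
Lemma vertices_delone i : delone (X i).
Proof.
split; last by case: (wD i).
have C0 := adapted_C0 _ _ _ _ hN.
have /has_ball_tile[c [r r0 sub]] := tile_has_ball (0, i).
exists (r / (2 * C * d.+1%:R)); first by rewrite divr_gt0 ?mulr_gt0.
apply: discrete_with1 => [x|c' x y Xx Xy xc yc].
  exact: (multiplicity_le1 A D uA X irr v0 X0 loop_v0 hS multiplicity_bounded).
apply: contrapT => /eqP xy.
have xyr : N (x - y) < r.
  have -> : x - y = (x - c') - (y - c') by rewrite opprB addrA subrK.
  apply: le_lt_trans (adaptedB hN _ _) _.
  have half z : enorm (z - c') < r / (2 * C * d.+1%:R) -> N (z - c') < r / 2.
    move=> zc; apply: le_lt_trans (adapted_le _ _ _ _ hN _) _.
    apply: le_lt_trans (_ : C * (d%:R * (r / (2 * C * d.+1%:R))) < _).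
      rewrite ler_wpM2l ?(ltW C0)//; apply: le_trans (l1norm_le_enorm _) _.
      by rewrite ler_wpM2l// ltW.
    have -> : C * (d%:R * (r / (2 * C * d.+1%:R))) = r / 2 * (d%:R / d.+1%:R).
      by field; rewrite nat1r pnatr_eq0 (gt_eqF C0).
    by rewrite gtr_pMr ?divr_gt0// ltr_pdivrMr// mul1r ltr_nat.
  by have := half x xc; have := half y yc; lra.
have xyi : (x, i) != (y, i) by apply: contra xy => /eqP[->].
apply: (tiles_overlap_free (x, i) (y, i) Xx Xy xyi).
exists (c + x), (r - N (x - y)); first by rewrite subr_gt0.
have in_tile z : Nball (c + z) r `<=` tile (z, i).
  move=> q qc; apply/tileE; apply: sub.
  by move: qc; rewrite /Nball /= opprD addrA addrAC.
move=> q qx; split; apply: in_tile; move: q qx; apply: Nball_sub.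
  by rewrite subrr (adapted0 hN) subr0 gerDl oppr_le0 (adapted_ge0 hN).
by rewrite opprD addrACA subrr add0r.
Qed.

Lemma tile_lebesgue_gt0 i : compact (T i) -> (0 < lebesgue (T i))%E.
Proof.
move=> cpt; have C0 := adapted_C0 _ _ _ _ hN.
have /has_ball_tile[c [r r0 sub]] := tile_has_ball (0, i).
pose eta := r / (C * d.+1%:R).
have eta0 : 0 < eta by rewrite divr_gt0 ?mulr_gt0.
apply: lt_le_trans (lebesgue_cube_ge _ c eta cpt eta0 _).
  by rewrite lte_fin exprn_gt0// mulr_gt0.
move=> x xc; apply: sub; rewrite /Nball /=.
apply: le_lt_trans (adapted_le _ _ _ _ hN _) _.
apply: le_lt_trans (_ : C * (d%:R * eta) < _).
  rewrite ler_wpM2l ?(ltW C0)//; apply: le_trans (_ : \sum_(j < d) eta <= _).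
    by apply: ler_sum => j _; rewrite !mxE.
  by rewrite sumr_const card_ord mulr_natl.
have -> : C * (d%:R * eta) = r * (d%:R / d.+1%:R).
  by rewrite /eta; field; rewrite nat1r pnatr_eq0 (gt_eqF C0).
by rewrite gtr_pMr// ltr_pdivrMr// mul1r ltr_nat.
Qed.

End Tiling.

(** * Self-replicating multi-tilings *)

Theorem theorem7p1 (R : realType) (d n : nat) (hd : (0 < d)%N) (hn : (0 < n)%N)
    (A : 'M[R]_d) (hA : expanding A)
    (D : 'I_n -> 'I_n -> {fset 'cV[R]_d})
    (hS : primitive_mx (subdivision_matrix D))
    (X : multiset_family R d n)
    (hX : weak_delone_family A D X)
    (hirr : irreducible_family A D X)
    (c : seq ('cV[R]_d * 'I_n)) (hc : fundamental_cycle A D X c)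
    (hperiod : size c = 1%N) :
  self_replicating A D X.
Proof.
have uA := expanding_unitmx A hA.
have [th [C [N hN]]] := adapted_norm_exists d A hd hA.
have [v0 X0 loop_v0] : exists2 v, graph_vertex X v & graph_edge A D v v.
  move: hc hperiod => [_ _ + +]; case: c => [|v []]//= + + _.
  by rewrite !andbT; exists v.
have [_ wD] := hX.
have [T [T0 cptT solT]] := multitile_exists uA hN hS.
have clT i : Nclosed (N := N) (T i) := compact_Nclosed hN _ (cptT i).
have bdT (T' : 'I_n -> set 'cV[R]_d) : (forall i, compact (T' i)) ->
    forall i, exists r, forall x, T' i x -> N x <= r.
  by move=> cptT' i; have [r _ hr] := compact_Nbounded hN _ (cptT' i); exists r.
have [rho rho0 Trho] : exists2 rho, 0 <= rho & forall i x, T i x -> N x <= rho.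
  have /choice[r hr] := bdT T cptT.
  exists (\sum_i `|r i|); first exact: sumr_ge0.
  move=> i x /hr xr; apply: le_trans xr (le_trans (ler_norm _) _).
  by rewrite (bigD1 i)//= lerDl sumr_ge0.
split; first by case: hX.
  exact: (vertices_delone uA hN hS T T0 clT rho rho0 Trho solT X hirr v0 X0 loop_v0 wD).
exists T; split.
- by split=> //; apply/(solves_multitileP uA).
- move=> T' [T'0 /(solves_multitileP uA) solT'].
  have cptT' i : compact (T' i) by case: (T'0 i).
  apply/funext => i; apply/seteqP; split.
    exact: (solution_sub uA hN T T' T0 clT (bdT T cptT) (bdT T' cptT') solT solT').
  apply: (solution_sub uA hN T' T _ _ (bdT T' cptT') (bdT T cptT) solT' solT).
    by move=> j; case: (T'0 j).
  by move=> j; exact: (compact_Nclosed hN _ (cptT' j)).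
- move=> i; apply: (tile_lebesgue_gt0 uA hN hS T T0 clT rho rho0 Trho solT X hirr v0) => //.
split.
  apply/seteqP; split=> // p _.
  have [v Xv vp] := tiles_cover uA hN T T0 clT rho rho0 Trho solT X hirr v0 wD p.
  by exists v.2 => //; exists v.1.
move=> i j x y Xx Xy ixy.
apply: (contact_null uA hN hS T T0 clT rho rho0 Trho solT X hirr v0 X0 loop_v0 wD
  (x, i) (y, j)) => //.
by apply/eqP => -[xy ij]; apply: ixy; rewrite xy ij.
Qed.
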